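(* Let $Q$ be a smooth manifold of dimension $n$ and let $L$ be a regular Lagrangian on $TQ$. Then there is a unique second-order differential equation field $\Gamma$ on $TQ$ such that $$\Gamma(Z^{\mathrm V}(L))-Z^{\mathrm C}(L)=0$$ for all vector fields $Z$ on $Q$. Moreover, $\Gamma$ may be determined from the equations $$\Gamma(X_i^{\mathrm V}(L))-X_i^{\mathrm C}(L)=0,\qquad i=1,2,\ldots,n,$$ for any frame $\{X_i\}$ on $Q$ (which may be a coordinate frame or may be anholonomic); that is, over the domain of the frame, $\Gamma$ is the unique second-order differential equation field satisfying these $n$ equations.
   Context: $\tau:TQ\to Q$ is the tangent bundle projection; $q^i$ are local coordinates on $Q$ and $u^i$ the corresponding fibre coordinates on $TQ$. Summation convention is used. For a (locally defined) vector field $Z=Z^i\,\partial/\partial q^i$ on $Q$: the complete lift $Z^{\mathrm C}$ is the vector field on $TQ$ whose flow consists of the tangent maps of the flow of $Z$, i.e. $Z^{\mathrm C}=Z^i\frac{\partial}{\partial q^i}+u^j\frac{\partial Z^i}{\partial q^j}\frac{\partial}{\partial u^i}$; the vertical lift is $Z^{\mathrm V}=Z^i\frac{\partial}{\partial u^i}$. A second-order differential equation field is a vector field $\Gamma$ on $TQ$ with $\tau_{*(q,u)}\Gamma=u$ for all $(q,u)\in TQ$, i.e. $\Gamma=u^i\frac{\partial}{\partial q^i}+F^i\frac{\partial}{\partial u^i}$ in coordinates. A Lagrangian is a smooth function $L$ on $TQ$; it is regular if its Hessian with respect to the velocities, $\left(\frac{\partial^2L}{\partial u^i\partial u^j}\right)$,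 is everywhere nonsingular. A frame on $Q$ is a local basis $\{X_i\}$, $i=1,\ldots,n$, of vector fields; it is anholonomic if it is not (or is not known to be) a coordinate frame. *)

(* Defs.v *)
From HB Require Import structures.
From mathcomp Require Import all_boot all_order all_algebra.
From mathcomp Require Import all_classical all_reals all_analysis.

Set Implicit Arguments.
Unset Strict Implicit.
Unset Printing Implicit Defensive.

Import GRing.Theory numFieldNormedType.Exports.
Local Open Scope classical_set_scope.
Local Open Scope ring_scope.

(* C^k and C^oo on a subset A of the (finite-dimensional) model space; only
   used for open A. *)
Fixpoint Ck (R : realType) (E F : normedModType R) (k : nat) (A : set E)
    (f : E -> F) : Prop :=
  match k with
  | 0%N => forall x, A x -> {for x, continuous f}
  | k'.+1 => (forall x, A x -> differentiable f x) /\
             (forall v : E, Ck k' A (fun x => 'D_v f x))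
  end.

Definition smooth_on (R : realType) (E F : normedModType R) (A : set E)
    (f : E -> F) : Prop := forall k, Ck k A f.

(* Charts on a set M modelled on E.  The map [param i] is meant as the inverse
   of [coord i] and is only relevant on coord i @` dom i.  As in a "charted
   space", every point p comes with a preferred chart [pref p] around it. *)
Record charted (R : realType) (M : Type) (E : normedModType R) := Charted {
  chart_ix : Type;
  dom : chart_ix -> set M;
  coord : chart_ix -> M -> E;
  param : chart_ix -> E -> M;
  pref : M -> chart_ix
}.

Section Charts.
Context (R : realType) (M : Type) (E : normedModType R) (A : charted M E).

Definition chart_image (U : set M) (i : chart_ix A) : set E :=
  coord i @` (U `&` dom i).

(* The tangent space at q is E, a vector being given by its components in the
   preferred chart at q; [change i j q] is the induced change of components,
   the differential at q of the transition map from chart i to chart j. *)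
Definition change (i j : chart_ix A) (q : M) (v : E) : E :=
  'D_v (coord j \o param i) (coord i q).

Definition smooth_fun (F : normedModType R) (U : set M) (f : M -> F) : Prop :=
  forall i : chart_ix A, smooth_on (chart_image U i) (f \o param i).

(* A vector field assigns to q its components in the preferred chart at q;
   since [pref q] may jump with q, smoothness is that of the components
   [vf_loc X i], taken in a fixed chart i. *)
Definition vf_loc (X : M -> E) (i : chart_ix A) (x : E) : E :=
  let q := param i x in change (pref A q) i q (X q).

Definition smooth_vf (U : set M) (X : M -> E) : Prop :=
  forall i : chart_ix A, smooth_on (chart_image U i) (vf_loc X i).

(* X(f) *)
Definition vf_app (F : normedModType R) (X : M -> E) (f : M -> F) (p : M) : F :=
  'D_(X p) (f \o param (pref A p)) (coord (pref A p) p).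

End Charts.

Definition tangent_map (R : realType) (M N : Type) (E F : normedModType R)
    (A : charted M E) (B : charted N F) (f : M -> N) (p : M) (v : E) : F :=
  'D_v (coord (pref B (f p)) \o f \o param (pref A p)) (coord (pref A p) p).

Definition smooth_manifold (R : realType) (n : nat) (Q : topologicalType)
    (A : charted Q 'rV[R]_n) : Prop :=
  [/\ hausdorff_space Q, @second_countable Q,
      (forall q, dom (pref A q) q),
      (forall i : chart_ix A,
         [/\ open (dom i), open (coord i @` dom i),
             {in dom i, cancel (coord i) (param i)},
             (forall q, dom i q -> {for q, continuous (coord i)}) &
             (forall x, (coord i @` dom i) x ->
                {for x, continuous (param i)})]) &
      (forall i j : chart_ix A,
         smooth_on (chart_image (dom j) i) (coord j \o param i))].

Section TangentBundle.
Context (R : realType) (M : Type) (E : normedModType R) (A : charted M E).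

(* (q, u) is the tangent vector at q with components u in the preferred chart
   at q.  The set TM is a product, but its smooth structure is not: it is the
   one given by the charts [tangent_charts] below. *)
Definition tangent (_ : charted M E) : Type := (M * E)%type.

Definition tproj (p : tangent A) : M := p.1.

(* The natural charts (q^i, u^i), with the indices of the charts of M. *)
Definition tangent_charts : charted (tangent A) (E * E)%type :=
  @Charted R (tangent A) (E * E)%type (chart_ix A)
    (fun i => tproj @^-1` dom i)
    (fun i p => (coord i p.1, change (pref A p.1) i p.1 p.2))
    (fun i y => let q := param i y.1 in (q, change i (pref A q) q y.2))
    (fun p => pref A p.1).

(* At p = (q, u) the components below refer to the preferred chart of TM at p,
   which is the natural chart over the preferred chart at q; hence they are
   (0, Z^i) and (Z^i, u^j dZ^i/dq^j). *)
Definition vertical_lift (Z : M -> E) (p : tangent A) : (E * E)%type :=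
  (0, Z p.1).

Definition complete_lift (Z : M -> E) (p : tangent A) : (E * E)%type :=
  let i := pref A p.1 in (Z p.1, 'D_(p.2) (vf_loc Z i) (coord i p.1)).

(* A second-order differential equation field on TU. *)
Definition sode (U : set M) (G : tangent A -> (E * E)%type) : Prop :=
  smooth_vf tangent_charts (tproj @^-1` U) G /\
  (forall p : tangent A, U (tproj p) ->
     tangent_map tangent_charts A tproj p (G p) = p.2).

(* G(Z^V(L)) - Z^C(L) *)
Definition euler_lagrange (L : tangent A -> R) (G : tangent A -> (E * E)%type)
    (Z : M -> E) (p : tangent A) : R :=
  vf_app tangent_charts G (vf_app tangent_charts (vertical_lift Z) L) p
  - vf_app tangent_charts (complete_lift Z) L p.

End TangentBundle.

Section Lagrangian.
Context (R : realType) (n : nat) (Q : Type) (A : charted Q 'rV[R]_n).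

(* The derivative along the coordinate u^a. *)
Definition du (f : ('rV[R]_n * 'rV[R]_n)%type -> R) (a : 'I_n)
    (y : ('rV[R]_n * 'rV[R]_n)%type) : R :=
  'D_((0, delta_mx 0 a) : ('rV[R]_n * 'rV[R]_n)%type) f y.

Definition velocity_hessian (L : tangent A -> R) (i : chart_ix A)
    (p : tangent A) : 'M[R]_n :=
  let TA := tangent_charts A in
  \matrix_(a < n, b < n)
    du (du (L \o param (i : chart_ix TA)) b) a (coord (i : chart_ix TA) p).

Definition regular (L : tangent A -> R) : Prop :=
  forall (i : chart_ix A) (p : tangent A),
    dom i (tproj p) -> velocity_hessian L i p \in unitmx.

(* A frame over U; values of the fields outside U are irrelevant. *)
Definition frame (U : set Q) (X : 'I_n -> Q -> 'rV[R]_n) : Prop :=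
  (forall a, smooth_vf A U (X a)) /\
  (forall q, U q -> basis_of fullv [seq X a q | a : 'I_n]).

End Lagrangian.

(* Main.v *)
Require Import Defs.
From HB Require Import structures.
From mathcomp Require Import all_boot all_order all_algebra.
From mathcomp Require Import all_classical all_reals all_analysis.
From mathcomp Require Import ring lra.
Import numFieldNormedType.Exports.
Import Defs.
Import Order.TTheory GRing.Theory Num.Theory.
Local Open Scope classical_set_scope.
Local Open Scope ring_scope.

Set Implicit Arguments.
Unset Strict Implicit.
Unset Printing Implicit Defensive.

(** In natural coordinates the operator [Gamma (Z^V L) - Z^C L] is tensorial in
    [Z] when [Gamma] is a second-order field: the derivatives of the components
    of [Z] cancel, and what remains at a point [(x, v)] is the linear form
    [w |-> w^b ((v^a d/dx^a + F^a d/dv^a) (dL/dv^b) - dL/dx^b)] at [w = Z(x)].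
    Regularity makes its vanishing solvable for [F] in exactly one way, and
    vanishing on the values at [x] of a frame is enough.  By the symmetry of
    second derivatives the form is invariant under changes of chart, so the
    pointwise solutions have the smooth coordinate expression
    [F = (force) * (Hessian)^-1] in every chart.  Uniqueness among fields tested
    only on global [Z] needs a global field with any given value at a point,
    obtained from a bump function (here Hausdorffness of [Q] is used). *)

(** * Directional derivatives *)

Section Calculus.
Context (R : realType).
Implicit Types V W F : normedModType R.

(** The first-order expansion of [f] at [x] involves only values near [x], so it is also one of [g];
    [diff_unique] then identifies the differential. *)
Lemma near_differentiable V W (f g : V -> W) (x : V) :
  (\near x, f x = g x) -> differentiable f x -> differentiable g x.
Proof.
move=> fg df; have fgx := nbhs_singleton fg.
have H : g \o shift x = cst (g x) + 'd f x +o_ 0 id.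
  apply/eqaddoP => eps eps0; have /eqaddoP/(_ eps eps0) := diff_locally df.
  have : \forall z \near 0, f (z + x) = g (z + x).
    by move: fg; rewrite (near_shift 0) subr0.
  apply: filterS2 => z fgz; rewrite /GRing.add /GRing.opp /= fgz fgx; exact: id.
have cd : continuous ('d f x) by exact: diff_continuous.
by apply/diff_locallyP; rewrite (diff_unique cd H); split.
Qed.

Lemma derive_linear V W (f : V -> W) x : differentiable f x ->
  linear (fun v => 'D_v f x).
Proof. by move=> df a u v; rewrite !deriveE// linearP. Qed.

Lemma derive_compE V W F (f : V -> W) (g : W -> F) x v :
  differentiable f x -> differentiable g (f x) ->
  'D_v (g \o f) x = 'D_('D_v f x) g (f x).
Proof.
move=> df dg; rewrite !deriveE//; last exact: differentiable_comp.
by rewrite diff_comp.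
Qed.

Lemma derive_pairE V W F (f : V -> W) (g : V -> F) x v :
  differentiable f x -> differentiable g x ->
  'D_v (fun y => (f y, g y)) x = ('D_v f x, 'D_v g x).
Proof.
move=> df dg; rewrite !deriveE//; last exact: differentiable_pair.
by rewrite diff_pair.
Qed.

(** Scaling is a continuous bilinear map from [R * W] to [W]; the formula is the chain rule through
    [y |-> (h y, f y)]. *)
Lemma is_diff_scale V W (h dh : V -> R) (f df : V -> W) x :
  is_diff x h dh -> is_diff x f df ->
  is_diff x (fun y => h y *: f y) (fun y => h x *: df y + dh y *: f x).
Proof.
move=> hh hf.
have sB : bilinear_for (GRing.Scale.Law.clone _ _ *:%R _)
   (GRing.Scale.Law.clone _ _ *:%R _) (fun (h : R) (f : W) => h *: f).
  split => [u' a y z|u a y z] /=.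
  - by rewrite scalerDl -scalerA.
  - by rewrite scalerDr !scalerA mulrC.
pose bM := bilinear_isBilinear.Build R R W W _ _ (fun (h : R) (f : W) => h *: f) sB.
pose b : {bilinear R -> W -> W} := HB.pack (fun (h : R) (f : W) => h *: f) bM.
have cb : continuous (fun p : R * W => b p.1 p.2).
  by move=> [u v]; apply: cvgZ; [exact: cvg_fst|exact: cvg_snd].
have db : is_diff (h x, f x) (fun p : R * W => b p.1 p.2)
   (fun q => b (h x) q.2 + b q.1 (f x)).
  by apply: DiffDef; [exact: differentiable_bilin|rewrite diff_bilin].
apply: is_diff_eq.
  by apply: (is_diff_comp (f := fun y => (h y, f y)) _ db).
by [].
Qed.

End Calculus.

(** * Calculus of C^k maps *)

Section Smoothness.
Context (R : realType).
Implicit Types V W F : normedModType R.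

Lemma near_open (T : topologicalType) (A : set T) (P : T -> Prop) x :
  open A -> A x -> (forall y, A y -> P y) -> \forall y \near x, P y.
Proof. by move=> oA Ax AP; apply: (filterS AP); exact: open_nbhs_nbhs. Qed.

Lemma Ck_sub V F k (A B : set V) (f : V -> F) :
  B `<=` A -> Ck k A f -> Ck k B f.
Proof.
move=> BA; elim: k f => [|k IH] f /= fA; first by move=> x /BA /fA.
by split=> [x /BA|v]; [case: fA => + _; exact|apply: IH; case: fA].
Qed.

(** The two maps may differ outside [A]. Openness makes them agree near each point of [A], so their
    directional derivatives agree on [A] again and the induction proceeds. *)
Lemma Ck_eq V F k (A : set V) (f g : V -> F) : open A ->
  (forall x, A x -> f x = g x) -> Ck k A f -> Ck k A g.
Proof.
move=> oA; elim: k f g => [|k IH] f g fg /=.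
  move=> fA x Ax; change (g @ x --> g x); rewrite -(fg x Ax).
  apply: cvg_trans (fA x Ax); apply: near_eq_cvg.
  by apply: (near_open oA Ax) => y /fg.
case=> df fA; split=> [x Ax|v].
  apply: near_differentiable (df x Ax); exact: (near_open oA Ax).
apply: IH (fA v) => x Ax; apply: near_eq_derive; exact: (near_open oA Ax).
Qed.

Lemma Ck_continuous V F k (A : set V) (f : V -> F) x :
  Ck k A f -> A x -> {for x, continuous f}.
Proof.
case: k => [|k] /= fA Ax; first exact: fA.
by apply: differentiable_continuous; case: fA => + _; exact.
Qed.

Lemma CkS V F k (A : set V) (f : V -> F) : Ck k.+1 A f -> Ck k A f.
Proof.
elim: k f => [|k IH] f fA; first by move=> x; exact: (Ck_continuous fA).
by case: fA => df fA; split=> // v; apply: IH.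
Qed.

Lemma Ck_cst V F k (A : set V) (c : F) : Ck k A (fun _ => c).
Proof.
elim: k c => [|k IH] c /=; first by move=> x _; exact: cvg_cst.
split=> [x _|v]; first exact: differentiable_cst.
have -> : (fun x : V => 'D_v (fun _ : V => c) x) = (fun _ => 0).
  by apply/funext => x; rewrite (derive_cst c).
exact: IH.
Qed.

(** Each clause of [Ck] is a condition at single points on globally defined maps, so it can be
    checked on pieces. This glues a field cut off by a bump function to its zero extension. *)
Lemma CkU V F k (A B : set V) (f : V -> F) :
  Ck k A f -> Ck k B f -> Ck k (A `|` B) f.
Proof.
elim: k f => [|k IH] f /=; first by move=> fA fB x [/fA|/fB].
by move=> [dfA fA] [dfB fB]; split=> [x [/dfA|/dfB]//|v]; exact: IH.
Qed.

Lemma CkD V F k (A : set V) (f g : V -> F) : open A ->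
  Ck k A f -> Ck k A g -> Ck k A (fun x => f x + g x).
Proof.
move=> oA; elim: k f g => [|k IH] f g /=.
  by move=> fA gA x Ax; apply: cvgD; [exact: fA|exact: gA].
move=> [df fA] [dg gA]; split=> [x Ax|v].
  by apply: (@differentiableD _ _ _ f g); [exact: df|exact: dg].
apply: (Ck_eq oA _ (IH _ _ (fA v) (gA v))) => x Ax.
by rewrite -deriveD//; apply: diff_derivable; [exact: df|exact: dg].
Qed.

Lemma Ck_sum V F k (A : set V) (I : Type) (r : seq I) (P : pred I)
    (f : I -> V -> F) : open A ->
  (forall i, Ck k A (f i)) -> Ck k A (fun x => \sum_(i <- r | P i) f i x).
Proof.
move=> oA fA; elim: r => [|i r IH].
  by apply: Ck_eq (Ck_cst _ _ 0) => // x; rewrite big_nil.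
case Pi : (P i).
  by apply: Ck_eq (CkD oA (fA i) IH) => // x; rewrite big_cons Pi.
by apply: Ck_eq IH => // x; rewrite big_cons Pi.
Qed.

(** Leibniz rule: the factor left undifferentiated enters the induction with its order lowered by
    [CkS]. *)
Lemma Ck_scale V F k (A : set V) (h : V -> R) (f : V -> F) : open A ->
  Ck k A h -> Ck k A f -> Ck k A (fun x => h x *: f x).
Proof.
move=> oA; elim: k h f => [|k IH] h f.
  by move=> hA fA x Ax; apply: cvgZ; [exact: hA|exact: fA].
move=> hA fA; have := CkS hA; have := CkS fA.
case: hA fA => [dh hA] [df fA] fA' hA'.
have d x : A x -> is_diff x (fun y => h y *: f y)
    (fun y => h x *: 'd f x y + 'd h x y *: f x).
  by move=> Ax; apply: is_diff_scale; apply: differentiableP; [exact: dh|exact: df].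
split=> [x Ax|v]; first by case: (d x Ax).
apply: (Ck_eq oA _ (CkD oA (IH _ _ hA' (fA v)) (IH _ _ (hA v) fA'))) => x Ax.
case: (d x Ax) => dhf dE; rewrite [RHS]deriveE// dE !deriveE//;
  [exact: dh | exact: df].
Qed.

Lemma CkM V k (A : set V) (f g : V -> R) : open A ->
  Ck k A f -> Ck k A g -> Ck k A (fun x => f x * g x).
Proof. exact: Ck_scale. Qed.

Lemma CkB V F k (A : set V) (f g : V -> F) : open A ->
  Ck k A f -> Ck k A g -> Ck k A (fun x => f x - g x).
Proof.
move=> oA fA gA; apply: CkD => //.
apply: Ck_eq (Ck_scale oA (Ck_cst k A (-1 : R)) gA) => // x _.
by rewrite scaleN1r.
Qed.

Lemma Ck_prod V k (A : set V) (I : Type) (r : seq I) (f : I -> V -> R) :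
  open A -> (forall i, Ck k A (f i)) -> Ck k A (fun x => \prod_(i <- r) f i x).
Proof.
move=> oA fA; elim: r => [|i r IH].
  by apply: Ck_eq (Ck_cst _ _ (1 : R)) => // x; rewrite big_nil.
by apply: Ck_eq (CkM oA (fA i) IH) => // x; rewrite big_cons.
Qed.

(** The derivative of [1/f] is [-(1/f)^2] times that of [f], and [1/f] is already C^k by
    induction. *)
Lemma CkV V k (A : set V) (f : V -> R) : open A ->
  (forall x, A x -> f x != 0) -> Ck k A f -> Ck k A (fun x => (f x)^-1).
Proof.
move=> oA f0; elim: k => [|k IH] fA.
  by move=> x Ax; apply: cvgV; [exact: f0|exact: fA].
have IHA := IH (CkS fA); case: fA => df fA; split=> [x Ax|v].
  by apply: differentiableV; [exact: df|exact: f0].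
apply: (Ck_eq oA _ (CkM oA (CkM oA (Ck_cst k A (-1 : R)) (CkM oA IHA IHA)) (fA v))).
move=> x Ax; have [dfx fx0] := (df x Ax, f0 x Ax).
rewrite [RHS]deriveE ?deriveE//; last exact: differentiableV.
by rewrite diffV//= expr2 invfM mulN1r.
Qed.

(* For linear continuous [f], in a form that does not need the bundled type
   of linear maps. *)
Definition selfderiv V W (f : V -> W) : Prop :=
  forall x, is_diff x f f.

Lemma selfderiv_derive V W (f : V -> W) x v : selfderiv f -> 'D_v f x = f v.
Proof. by move=> df; case: (df x) => dfx E; rewrite deriveE// E. Qed.

Lemma Ck_selfderiv V W k (A : set V) (f : V -> W) : selfderiv f -> Ck k A f.
Proof.
move=> df; case: k => [|k] /=.
  by move=> x _; apply: differentiable_continuous; case: (df x).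
split=> [x _|v]; first by case: (df x).
have -> : (fun x : V => 'D_v f x) = (fun _ => f v).
  by apply/funext => x; exact: selfderiv_derive.
exact: Ck_cst.
Qed.

Lemma derive_selfderiv_comp V W F (l : W -> F) (f : V -> W) x v : selfderiv l ->
  differentiable f x -> 'D_v (l \o f) x = l ('D_v f x).
Proof.
move=> dl df; rewrite derive_compE//; first exact: selfderiv_derive.
by case: (dl (f x)).
Qed.

(** Directional derivatives commute with [l], so no direction varies here. [Ck_comp] relies on this
    case for the coordinate functions. *)
Lemma Ck_selfderiv_comp V W F k (A : set V) (l : W -> F) (f : V -> W) : open A ->
  selfderiv l -> Ck k A f -> Ck k A (l \o f).
Proof.
move=> oA dl; have lc y : differentiable l y by case: (dl y).
elim: k f => [|k IH] f /=.
  move=> fA x Ax; apply: continuous_comp; first exact: fA.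
  exact: differentiable_continuous.
case=> df fA; split=> [x Ax|v]; first by apply: differentiable_comp => //; exact: df.
apply: (Ck_eq oA _ (IH _ (fA v))) => x Ax.
by rewrite derive_selfderiv_comp//; exact: df.
Qed.

Lemma Ck_pair V W F k (A : set V) (f : V -> W) (g : V -> F) : open A ->
  Ck k A f -> Ck k A g -> Ck k A (fun x => (f x, g x)).
Proof.
move=> oA; elim: k f g => [|k IH] f g /=.
  by move=> fA gA x Ax; apply: cvg_pair; [exact: fA|exact: gA].
move=> [df fA] [dg gA]; split=> [x Ax|v].
  by apply: differentiable_pair; [exact: df|exact: dg].
apply: (Ck_eq oA _ (IH _ _ (fA v) (gA v))) => x Ax.
by rewrite derive_pairE//; [exact: df|exact: dg].
Qed.

Lemma selfderiv_fst V W : selfderiv (fst : V * W -> V).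
Proof.
move=> x; pose l := GRing.isLinear.Build R (V * W)%type V _ (fst : V * W -> V)
   (fun _ _ _ => erefl).
pose L : {linear _ -> _} := HB.pack (fst : V * W -> V) l.
have cL : continuous L by move=> p; exact: cvg_fst.
by apply: DiffDef; [exact: (@linear_differentiable _ _ _ L)|exact: (@diff_lin _ _ _ L)].
Qed.

Lemma selfderiv_snd V W : selfderiv (snd : V * W -> W).
Proof.
move=> x; pose l := GRing.isLinear.Build R (V * W)%type W _ (snd : V * W -> W)
   (fun _ _ _ => erefl).
pose L : {linear _ -> _} := HB.pack (snd : V * W -> W) l.
have cL : continuous L by move=> p; exact: cvg_snd.
by apply: DiffDef; [exact: (@linear_differentiable _ _ _ L)|exact: (@diff_lin _ _ _ L)].
Qed.

Lemma selfderiv_coord m n (i : 'I_m) (j : 'I_n) :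
  selfderiv (fun M : 'M[R]_(m, n) => M i j).
Proof.
move=> M.
have @f : {linear 'M[R]_(m, n) -> R}.
  by exists (fun N : 'M[R]_(_, _) => N i j); do 2![eexists]; do ?[constructor];
     rewrite ?mxE// => ? *; rewrite ?mxE//; move=> ?; rewrite !mxE.
have cf : continuous f by exact: coord_continuous.
by apply: DiffDef; [exact: (@linear_differentiable _ _ _ f)|exact: (@diff_lin _ _ _ f)].
Qed.

Lemma selfderiv_id V : selfderiv (id : V -> V).
Proof. by move=> x; exact: is_diff_id. Qed.

Lemma selfderiv_comp V W F (f : V -> W) (g : W -> F) :
  selfderiv f -> selfderiv g -> selfderiv (g \o f).
Proof. by move=> df dg x; apply: is_diff_comp. Qed.

(** A finite-dimensional structure on [V]: it turns a derivative along a variable vector into a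
    finite combination of derivatives along the fixed [cvec a], the only ones that [Ck] speaks
    of. *)
Record coordinates V := Coordinates {
  cidx : finType;
  cvec : cidx -> V;
  cof : cidx -> V -> R;
  cof_selfderiv : forall a, selfderiv (cof a);
  cof_sum : forall v, v = \sum_a cof a v *: cvec a }.

Lemma derive_coordinates V W (B : coordinates V) (f : V -> W) x v :
  differentiable f x -> 'D_v f x = \sum_a cof (c := B) a v *: 'D_(cvec a) f x.
Proof.
move=> df; rewrite deriveE// {1}(cof_sum B v) linear_sum.
by apply: eq_bigr => a _; rewrite linearZ deriveE.
Qed.

(** In the chain rule the direction ['D_v f x] moves with [x]; it is expanded in the coordinates of
    [W], with coefficients that are again C^k. *)
Lemma Ck_comp V W F (B : coordinates W) k (A : set V) (A' : set W)
    (f : V -> W) (g : W -> F) : open A -> (forall x, A x -> A' (f x)) ->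
  Ck k A f -> Ck k A' g -> Ck k A (g \o f).
Proof.
move=> oA AA'; elim: k g => [|k IH] g fA gA.
  by move=> x Ax; apply: continuous_comp; [exact: fA|apply: gA; exact: AA'].
have fA' := CkS fA; case: fA gA => [df fA] [dg gA]; split=> [x Ax|v].
  by apply: differentiable_comp; [exact: df|apply: dg; exact: AA'].
apply: (@Ck_eq _ _ _ _ (fun x =>
    \sum_a cof (c := B) a ('D_v f x) *: 'D_(cvec a) g (f x)) _ oA).
  move=> x Ax; rewrite derive_compE//; [|exact: df|by apply: dg; exact: AA'].
  by rewrite -derive_coordinates//; apply: dg; exact: AA'.
apply: Ck_sum => // a; apply: Ck_scale => //.
  by apply: (Ck_selfderiv_comp oA (cof_selfderiv a) (fA v)).
exact: (IH _ fA' (gA (cvec a))).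
Qed.

Lemma Ck_coordinates V W (B : coordinates W) k (A : set V) (f : V -> W) : open A ->
  (forall a, Ck k A (fun x => cof (c := B) a (f x))) -> Ck k A f.
Proof.
move=> oA fA; apply: (@Ck_eq _ _ _ _ (fun x =>
  \sum_a cof (c := B) a (f x) *: cvec a)) => //.
  by move=> x _; rewrite -cof_sum.
by apply: Ck_sum => // a; apply: Ck_scale => //; exact: Ck_cst.
Qed.

(** Kept transparent, like [prod_coordinates]: [derive_vertical] computes with the index types and
    the coefficients. *)
Definition row_coordinates n : coordinates 'rV[R]_n.
Proof.
exists 'I_n (fun a => delta_mx 0 a) (fun a (v : 'rV[R]_n) => v 0 a).
  by move=> a; exact: selfderiv_coord.
exact: row_sum_delta.
Defined.

Definition prod_coordinates V W (B : coordinates V) (C : coordinates W) :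
  coordinates (V * W)%type.
Proof.
exists (cidx B + cidx C)%type
  (fun s => match s with inl a => (cvec a, 0) | inr b => (0, cvec b) end)
  (fun s v => match s with inl a => cof a v.1 | inr b => cof b v.2 end).
  move=> [a|b]; apply: selfderiv_comp (cof_selfderiv _).
    exact: selfderiv_fst.
  exact: selfderiv_snd.
move=> [v w]; rewrite big_sumType /=.
have -> : \sum_a cof (c := B) a v *: (cvec a, 0 : W) = (v, 0).
  rewrite {2}(cof_sum B v).
  by apply: (big_ind2 (fun x y => x = (y, 0))) => [//|_ ? _ ? -> ->|a _];
    rewrite /= ?/GRing.add ?/GRing.scale /= /add_pair /scale_pair /= ?addr0 ?scaler0.
have -> : \sum_a cof (c := C) a w *: (0 : V, cvec a) = (0, w).
  rewrite {2}(cof_sum C w).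
  by apply: (big_ind2 (fun x y => x = (0, y))) => [//|_ ? _ ? -> ->|a _];
    rewrite /= ?/GRing.add ?/GRing.scale /= /add_pair /scale_pair /= ?addr0 ?scaler0.
by rewrite /GRing.add /= /add_pair /= addr0 add0r.
Defined.

End Smoothness.

(** * Symmetry of second derivatives *)

Section Schwarz.
Context (R : realType) (V : normedModType R).

Lemma is_derive_line (f : V -> R) (y w : V) (s : R) :
  differentiable f (y + s *: w) ->
  is_derive s (1 : R) (fun s : R => f (y + s *: w)) ('D_w f (y + s *: w)).
Proof.
move=> df.
have dl : is_diff s (fun s : R => y + s *: w) (fun s : R => s *: w).
  by apply: is_diff_eq; rewrite add0r.
have [dld dlE] := dl.
have dfl : differentiable (f \o (fun s : R => y + s *: w)) s.
  exact: differentiable_comp.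
apply: DeriveDef; first exact: diff_derivable.
by rewrite deriveE// diff_comp// dlE /= scale1r deriveE.
Qed.

Lemma MVT_line (f : V -> R) (y w : V) (t : R) : 0 < t ->
  (forall s, 0 <= s <= t -> differentiable f (y + s *: w)) ->
  exists2 s, 0 <= s <= t & f (y + t *: w) - f y = 'D_w f (y + s *: w) * t.
Proof.
move=> t0 df.
have dfl s : s \in `[0, t] ->
    is_derive s (1 : R) (fun s : R => f (y + s *: w)) ('D_w f (y + s *: w)).
  by rewrite in_itv => st; apply: is_derive_line; exact: df.
have dfo s : s \in `]0, t[ ->
    is_derive s (1 : R) (fun s : R => f (y + s *: w)) ('D_w f (y + s *: w)).
  by move=> /subset_itv_oo_cc; exact: dfl.
have cf : {within `[0, t], continuous (fun s : R => f (y + s *: w))}.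
  by apply: derivable_within_continuous => s sI; case: (dfl s sI).
have [s] := MVT t0 dfo cf.
rewrite in_itv /= => /andP[s0 st]; rewrite scale0r addr0 subr0 => ->.
by exists s => //; rewrite !ltW.
Qed.

(* Symmetric in [u] and [v] on the left, which is what yields [derive_swap]. *)
Lemma second_difference (f : V -> R) (A : set V) (x u v : V) (t : R) :
  Ck 2 A f -> 0 < t ->
  (forall a b, 0 <= a <= t -> 0 <= b <= t -> A (x + a *: u + b *: v)) ->
  exists a b, [/\ 0 <= a <= t, 0 <= b <= t &
    f (x + t *: u + t *: v) - f (x + t *: u) - (f (x + t *: v) - f x) =
    'D_v (fun y => 'D_u f y) (x + a *: u + b *: v) * t * t].
Proof.
move=> [df dfu] t0 xA.
have tt : 0 <= t <= t by rewrite lexx ltW.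
have t00 : 0 <= (0 : R) <= t by rewrite lexx ltW.
(* The second difference is the increment of [g] along [t *: u]. The mean value theorem is applied
   to [g] along [u], then to ['D_u f] along [v]. *)
pose g y := f (y + t *: v) - f y.
have dT s : 0 <= s <= t ->
    is_diff (x + s *: u) (fun y => f (y + t *: v) - f y)
      (fun h => 'd f (x + s *: u + t *: v) h - 'd f (x + s *: u) h).
  move=> st.
  have d1 : is_diff (x + s *: u) f ('d f (x + s *: u)).
    apply: differentiableP; apply: df; have := xA s 0 st t00.
    by rewrite scale0r addr0.
  have d2 : is_diff (x + s *: u + t *: v) f ('d f (x + s *: u + t *: v)).
    by apply: differentiableP; apply: df; exact: xA.
  have d3 : is_diff (x + s *: u) (fun y => y + t *: v) id.
    by apply: is_diff_eq; rewrite addr0.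
  exact: (is_diffB (is_diff_comp d3 d2) d1).
have [a at' E] : exists2 a, 0 <= a <= t & g (x + t *: u) - g x =
    'D_u g (x + a *: u) * t.
  by apply: (@MVT_line g x u t t0) => s st; case: (dT s st).
have [b bt E'] : exists2 b, 0 <= b <= t &
    'D_u f (x + a *: u + t *: v) - 'D_u f (x + a *: u) =
    'D_v (fun y => 'D_u f y) (x + a *: u + b *: v) * t.
  apply: (@MVT_line (fun y => 'D_u f y) (x + a *: u) v t t0) => s st.
  by case: (dfu u) => d _; apply: d; exact: xA.
exists a, b; split=> //; rewrite -/(g _) -/(g _) E -E'; congr (_ * _).
have [dg dgE] := dT a at'; rewrite deriveE// dgE !deriveE//.
  by apply: df; have := xA a 0 at' t00; rewrite scale0r addr0.
by apply: df; exact: xA.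
Qed.

(** The same second difference is [t * t] times either mixed derivative, each at some point near
    [x]. The two values thus coincide, and continuity at [x] brings the mixed derivatives at [x]
    within any [e] of each other. *)
Lemma derive_swap (f : V -> R) (A : set V) (x u v : V) : open A -> A x ->
  Ck 2 A f ->
  'D_u (fun y => 'D_v f y) x = 'D_v (fun y => 'D_u f y) x.
Proof.
move=> oA Ax fA; pose P y := 'D_u (fun y => 'D_v f y) y.
pose Q y := 'D_v (fun y => 'D_u f y) y; rewrite -/(P x) -/(Q x).
have cD a b : {for x, continuous (fun y => 'D_a (fun y => 'D_b f y) y)}.
  by case: fA => _ /(_ b) [_ /(_ a)] /(_ x Ax).
apply/eqP; rewrite -subr_eq0 -normr_le0; apply/ler_addgt0Pr => e e0; rewrite add0r.
have e2 : 0 < e / 2 by rewrite divr_gt0.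
have nP : \forall y \near x, `|P x - P y| < e / 2.
  by exact: (cvgrPdist_lt _ _).1 (cD u v) _ e2.
have nQ : \forall y \near x, `|Q x - Q y| < e / 2.
  by exact: (cvgrPdist_lt _ _).1 (cD v u) _ e2.
have nA : \forall y \near x, A y by exact: open_nbhs_nbhs.
have N : \forall y \near x, [/\ A y, `|P x - P y| < e / 2 & `|Q x - Q y| < e / 2].
  by apply: filterS3 nA nP nQ.
have /nbhs_ballP[r /= r0 rx] := N.
(* Small enough that the whole parallelogram of sides [t *: u] and [t *: v] lies in the ball; the
   [1] keeps the denominator positive when [u] and [v] vanish. *)
pose t := r / (`|u| + `|v| + 1).
have m0 : 0 < `|u| + `|v| + 1 by rewrite ltr_wpDl// addr_ge0.
have t0 : 0 < t by rewrite divr_gt0.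
have bx a b : 0 <= a <= t -> 0 <= b <= t -> ball x r (x + a *: u + b *: v).
  move=> /andP[a0 a1] /andP[b0 b1]; rewrite -ball_normE /= -addrA opprD addNKr.
  rewrite normrN (le_lt_trans (ler_normD _ _))// !normrZ !ger0_norm//.
  apply: (@le_lt_trans _ _ (t * (`|u| + `|v|))).
    by rewrite mulrDr lerD// ler_wpM2r.
  by rewrite /t mulrAC ltr_pdivrMr// ltr_pM2l// ltrDl.
have [a1 [b1 [ha1 hb1 E1]]] : exists a b, [/\ 0 <= a <= t, 0 <= b <= t & _] :=
  @second_difference f A x u v t fA t0
    (fun a b ha hb => let: And3 h _ _ := rx _ (bx a b ha hb) in h).
have bx' a b : 0 <= a <= t -> 0 <= b <= t -> ball x r (x + a *: v + b *: u).
  by move=> ha hb; rewrite addrAC; exact: bx.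
have [a2 [b2 [ha2 hb2 E2]]] : exists a b, [/\ 0 <= a <= t, 0 <= b <= t & _] :=
  @second_difference f A x v u t fA t0
    (fun a b ha hb => let: And3 h _ _ := rx _ (bx' a b ha hb) in h).
have Ed : f (x + t *: u + t *: v) - f (x + t *: u) - (f (x + t *: v) - f x) =
    f (x + t *: v + t *: u) - f (x + t *: v) - (f (x + t *: u) - f x).
  by rewrite [x + t *: v + _]addrAC; ring.
have tn : t != 0 by rewrite gt_eqF.
have /(mulIf tn)/(mulIf tn) : Q (x + a1 *: u + b1 *: v) * t * t =
    P (x + a2 *: v + b2 *: u) * t * t := etrans (esym E1) (etrans Ed E2).
move: (x + a1 *: u + b1 *: v) (x + a2 *: v + b2 *: u) (bx _ _ ha1 hb1)
  (bx' _ _ ha2 hb2) => y1 y2 /rx[_ _ h1] /rx[_ h2 _] E.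
have -> : P x - Q x = (P x - P y2) - (Q x - Q y1).
  by rewrite E opprB addrA subrK.
apply: ltW; apply: le_lt_trans (ler_normB _ _) _.
by clearbody P Q; have := ltrD h2 h1; rewrite -splitr; exact.
Qed.

End Schwarz.

(** * Bump functions *)

Section Bump.
Context (R : realType).

(* The factor [t^-m] keeps the family closed under differentiation:
   [flat m]' = [flat m.+2] - m [flat m.+1], also at 0. *)
Definition flat (m : nat) (t : R) : R :=
  if 0 < t then t^-1 ^+ m * expR (- t^-1) else 0.

(** With [s = 1/t], one term of the exponential series gives [s^(m+2) / (m+2)! <= exp s]. The
    quadratic bound is what makes the derivative at 0 exist and vanish. *)
Lemma flat_le m t : `|flat m t| <= (m.+2)`!%:R * `|t| ^+ 2.
Proof.
rewrite /flat; case: ifPn => [t0|_]; last by rewrite normr0 mulr_ge0// exprn_ge0.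
have s0 : 0 < t^-1 by rewrite invr_gt0.
rewrite ger0_norm; last by rewrite mulr_ge0 ?expR_ge0// exprn_ge0// ltW.
rewrite (gtr0_norm t0) expRN ler_pdivrMr ?expR_gt0//.
have f0 : 0 < (m.+2)`!%:R :> R by rewrite ltr0n fact_gt0.
have he : t^-1 ^+ m.+2 / (m.+2)`!%:R <= expR t^-1.
  by apply: le_trans (expR_ge1Dxn m.+1 (ltW s0)); rewrite lerDr.
have E : t^-1 ^+ m.+2 = t^-1 ^+ m * t^-1 ^+ 2 by rewrite -exprD addn2.
have -> : t^-1 ^+ m = (m.+2)`!%:R * t ^+ 2 * (t^-1 ^+ m.+2 / (m.+2)`!%:R).
  rewrite E; move: (t^-1 ^+ m) f0 => a; move: (_%:R) => c c0.
  by field; rewrite !gt_eqF.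
by rewrite ler_wpM2l// mulr_ge0 ?exprn_ge0// ltW.
Qed.

Lemma is_derive_flat m t :
  is_derive t (1 : R) (flat m) (flat m.+2 t - m%:R * flat m.+1 t).
Proof.
have [t0|t0|->] := ltgtP t 0.
- have -> : flat m.+2 t - m%:R * flat m.+1 t = 0.
    by rewrite /flat ltNge ltW//= mulr0 subr0.
  apply: (@near_eq_is_derive R R R (cst (0 : R))).
    near=> s; rewrite /flat ltNge ltW//.
    by near: s; exact: lt_nbhsl.
- apply: (@near_eq_is_derive R R R (fun t : R => t^-1 ^+ m * expR (- t^-1))).
    near=> s; rewrite /flat ifT//.
    by near: s; exact: lt_nbhsr.
  have tn0 : t != 0 by rewrite gt_eqF.
  have dV : is_derive t (1 : R) (fun t : R => t^-1) (- t ^- 2).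
    apply: DeriveDef; first by apply: derivableV => //; exact: derivable_id.
    by rewrite deriveV//= ?derive_id ?scaler1//; exact: derivable_id.
  have dE : is_derive t (1 : R) (fun t : R => expR (- t^-1))
      (t ^- 2 * expR (- t^-1)).
    have dN := @is_deriveN _ _ _ _ _ _ _ dV.
    have dC := @is_derive1_comp R expR (fun t : R => - t^-1) t _ _ (is_derive_expR _) dN.
    rewrite -[X in is_derive _ _ _ X](_ : expR (- t^-1) * - - t ^- 2 = _).
      exact: dC.
    by rewrite opprK mulrC.
  have dX := @is_deriveX R _ (fun t : R => t^-1) m t 1 _ dV.
  have dM := is_deriveM dX dE.
  rewrite exprfctE in dM.
  apply: (is_derive_eq dM).
  rewrite /flat t0 /GRing.scale /=.
  rewrite -exprVn; set e := expR _; set s := t^-1; clearbody e s.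
  case: (m) => [|k] /=; first by ring.
  by rewrite !exprS; ring.
- have -> : flat m.+2 0 - m%:R * flat m.+1 0 = 0.
    by rewrite /flat ltxx mulr0 subr0.
  (* By [flat_le] the difference quotient at 0 is at most [(m+2)!] times the absolute value of the
     increment. *)
  have H : h^-1 *: (flat m (h *: 1 + 0) - flat m 0) @[h --> (0:R)^'] --> (0 : R).
    apply/cvgrPdist_le => e e0; near=> k.
    have k0 : k != 0 by near: k; exact: nbhs_dnbhs_neq.
    rewrite sub0r normrN /flat ltxx subr0 addr0 -/(flat m _) [k *: _]mulr1.
    rewrite normrZ normfV ler_pdivrMl ?normr_gt0// mulrC.
    rewrite (le_trans (flat_le _ _))// expr2 mulrA ler_wpM2r// -ler_pdivlMl.
      near: k; apply: dnbhs0_le; rewrite mulr_gt0// invr_gt0 ltr0n fact_gt0//.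
    by rewrite ltr0n fact_gt0.
  apply: DeriveDef; first by apply/cvg_ex; exists 0.
  by apply/cvg_lim.
Unshelve. all: by end_near. Qed.

(** The induction on [k] is over all [m] at once, since each differentiation raises [m]. *)
Lemma Ck_flat k m : Ck k setT (flat m).
Proof.
elim: k m => [|k IH] m.
  move=> t _; apply: differentiable_continuous; apply/derivable1_diffP.
  by case: (is_derive_flat m t).
have d t : differentiable (flat m) t.
  by apply/derivable1_diffP; case: (is_derive_flat m t).
split=> // v.
apply: (@Ck_eq _ _ _ _ _ (fun t => v * (flat m.+2 t - m%:R * flat m.+1 t))).
- exact: openT.
- move=> t _; have [_ <-] := is_derive_flat m t.
  by rewrite !deriveE// -[in RHS](mulr1 v) [RHS]linearZ.
- apply: CkM; [exact: openT|exact: Ck_cst|].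
  apply: CkB; [exact: openT|exact: IH|].
  by apply: CkM; [exact: openT|exact: Ck_cst|exact: IH].
Qed.

Definition real_coordinates : coordinates R.
Proof.
exists unit (fun _ => 1 : R) (fun _ => id : R -> R).
  by move=> _; exact: selfderiv_id.
by move=> v; rewrite (big_pred1 tt) => [|[]//]; rewrite [RHS]mulr1.
Defined.

(** The bump is [flat 0] of [r^2] minus the squared Euclidean distance to [x0], normalised at [x0].
    The compact set is the closed cube of half-side [r], which contains the Euclidean ball of radius
    [r]. *)
Lemma bump_exists n (x0 : 'rV[R]_n) (W : set 'rV[R]_n) : nbhs x0 W ->
  exists (rho : 'rV[R]_n -> R) (K : set 'rV[R]_n),
    [/\ smooth_on setT rho, rho x0 = 1, compact K, K `<=` W &
        forall x, ~ K x -> rho x = 0].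
Proof.
(* Balls of row vectors are cubes; halving the radius puts the closed cube inside the open one. *)
move=> /nbhs_ballP[e /= e0 eW]; pose r := e / 2.
have r0 : 0 < r by rewrite divr_gt0.
pose sq (x : 'rV[R]_n) := r ^+ 2 - \sum_(i < n) (x 0 i - x0 0 i) ^+ 2.
have fr : flat 0 (r ^+ 2) != 0.
  by rewrite /flat exprn_gt0// expr0 mul1r gt_eqF// expR_gt0.
exists (fun x => flat 0 (sq x) * (flat 0 (r ^+ 2))^-1).
exists [set x | forall i, `[x0 0 i - r, x0 0 i + r]%classic (x ord0 i)].
split.
- move=> k; apply: CkM; [exact: openT| |exact: Ck_cst].
  apply: (Ck_comp real_coordinates (A' := setT) (f := sq)) => //; last exact: Ck_flat.
    exact: openT.
  apply: CkB; [exact: openT|exact: Ck_cst|apply: Ck_sum; first exact: openT].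
  move=> i; have h : Ck k setT (fun x : 'rV[R]_n => x 0 i - x0 0 i).
    apply: CkB; [exact: openT| |exact: Ck_cst].
    by apply: Ck_selfderiv; exact: selfderiv_coord.
  exact: (CkM openT h h).
- rewrite /sq big1 ?subr0 ?divff// => i _.
  by rewrite subrr expr0n.
- apply: (@rV_compact R n (fun i => `[x0 0 i - r, x0 0 i + r]%classic)) => i.
  exact: segment_compact.
- move=> x Kx; apply: eW; split=> // i j; rewrite (ord1 i).
  have := Kx j; rewrite /= in_itv /= => /andP[h1 h2].
  rewrite /ball /= ltr_norml; move: h1 h2 e0; rewrite /r.
  by move: (x0 0 j) (x 0 j) => a b; lra.
(* Outside the cube some coordinate differs by more than [r], so the argument of [flat] is at most
   0. *)
- move=> x /existsNP[i xi]; rewrite /flat ifF ?mul0r//.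
  apply/negbTE; rewrite -leNgt subr_le0 (bigD1 i)//=.
  rewrite -[leLHS]addr0 lerD//; last by apply: sumr_ge0 => j _; exact: sqr_ge0.
  rewrite leNgt; apply/negP => lt; apply: xi; rewrite /= in_itv /=.
  have : `|x 0 i - x0 0 i| < r.
    by rewrite -(@ltr_pXn2r _ 2)// ?nnegrE ?(ltW r0)// -normrX ger0_norm ?sqr_ge0.
  by rewrite ltr_norml; move: (x0 0 i) (x 0 i) => a b; lra.
Qed.

End Bump.

Local Opaque derive diff.

(** * Derivatives along varying directions *)

Section DirectionalFields.
Context (R : realType).
Implicit Types U V F : normedModType R.

Lemma is_diff_sum V F (x : V) (I : Type) (r : seq I) (f df : I -> V -> F) :
  (forall i, is_diff x (f i) (df i)) ->
  is_diff x (fun y => \sum_(i <- r) f i y) (fun h => \sum_(i <- r) df i h).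
Proof.
move=> fd; elim: r => [|i r IH].
  have -> : (fun y => \sum_(i <- [::]) f i y) = cst 0.
    by apply/funext => y; rewrite big_nil.
  have -> : (fun h => \sum_(i <- [::]) df i h) = 0.
    by apply/funext => y; rewrite big_nil.
  exact: is_diff_cst.
have -> : (fun y => \sum_(i <- i :: r) f i y) =
    f i + (fun y => \sum_(i <- r) f i y).
  by apply/funext => y; rewrite big_cons.
have -> : (fun y => \sum_(i <- i :: r) df i y) =
    df i + (fun y => \sum_(i <- r) df i y).
  by apply/funext => y; rewrite big_cons.
exact: is_diffD.
Qed.

(** Direction and base point both depend on [y]. In coordinates this is a sum of products of C^k
    maps, one order of [f] being spent on the derivative. *)
Lemma Ck_derive_field U V F (B : coordinates V) k (D : set U) (A : set V)
    (f : V -> F) (c p : U -> V) :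
  open D -> open A -> (forall y, D y -> A (p y)) ->
  Ck k D c -> Ck k D p -> Ck k.+1 A f ->
  Ck k D (fun y => 'D_(c y) f (p y)).
Proof.
move=> oD oA DA cD pD [df fA].
apply: (@Ck_eq _ _ _ _ _ (fun y =>
  \sum_a cof (c := B) a (c y) *: 'D_(cvec a) f (p y)) _ oD).
  by move=> y Dy; rewrite -derive_coordinates//; apply: df; exact: DA.
apply: Ck_sum => // a; apply: Ck_scale => //.
  exact: (Ck_selfderiv_comp oD (cof_selfderiv a) cD).
exact: (Ck_comp B oD DA pD (fA (cvec a))).
Qed.

Lemma is_diff_inr U V F (f df : U -> F) (y : U) : is_diff y f df ->
  is_diff y (fun z => (0 : V, f z)) (fun h => (0, df h)).
Proof.
move=> [d E]; have d0 : differentiable (cst (0 : V) : U -> V) y by [].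
apply: DiffDef; first exact: (differentiable_pair d0 d).
by rewrite (diff_pair d0 d) E; apply/funext => h; rewrite diff_cst.
Qed.

(** Leibniz rule for a derivative along a field: one term moves the base point with the direction
    frozen, the other differentiates the direction, on which the derivative depends linearly. *)
Lemma derive_field U V F (B : coordinates V) (D : set U) (A : set V)
    (f : V -> F) (c p : U -> V) (y h : U) :
  open D -> open A -> (forall y, D y -> A (p y)) -> D y -> Ck 2 A f ->
  differentiable c y -> differentiable p y ->
  'D_h (fun y => 'D_(c y) f (p y)) y =
  'D_('D_h p y) (fun z => 'D_(c y) f z) (p y) + 'D_('D_h c y) f (p y).
Proof.
move=> oD oA DA Dy [df f2A] dc dp; have Apy := DA _ Dy.
have dfe (v z : V) : A z -> differentiable (fun z => 'D_v f z) z.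
  by move=> Az; case: (f2A v) => + _; exact.
have -> : 'D_h (fun y => 'D_(c y) f (p y)) y =
    'D_h (fun y => \sum_a cof (c := B) a (c y) *: 'D_(cvec a) f (p y)) y.
  apply: near_eq_derive; apply: (near_open oD Dy) => z Dz.
  by rewrite -derive_coordinates//; apply: df; exact: DA.
have -> : 'D_('D_h p y) (fun z => 'D_(c y) f z) (p y) =
   'D_('D_h p y) (fun z => \sum_a cof (c := B) a (c y) *: 'D_(cvec a) f z) (p y).
  apply: near_eq_derive; apply: (near_open oA Apy) => z Az.
  by rewrite -derive_coordinates//; exact: df.
have d1 a : is_diff y (fun y => cof (c := B) a (c y) *: 'D_(cvec a) f (p y))
   (fun h => cof (c := B) a (c y) *:
        'd (fun z => 'D_(cvec (c := B) a) f z) (p y) ('d p y h)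
      + cof (c := B) a ('d c y h) *: 'D_(cvec a) f (p y)).
  apply: is_diff_scale.
    by apply: is_diff_comp (cof_selfderiv a (c y)); exact: differentiableP.
  apply: (@is_diff_comp _ _ _ _ p ('d p y) (fun z => 'D_(cvec (c := B) a) f z)).
    exact: differentiableP.
  by apply: differentiableP; exact: dfe.
have d2 a : is_diff (p y) (fun z => cof (c := B) a (c y) *: 'D_(cvec a) f z)
   (fun h => cof (c := B) a (c y) *:
        'd (fun z => 'D_(cvec (c := B) a) f z) (p y) h).
  apply: (@is_diff_comp _ _ _ _ (fun z => 'D_(cvec (c := B) a) f z) _
     ( *:%R (cof (c := B) a (c y)))).
  by apply: differentiableP; exact: dfe.
have [ds1 E1] := is_diff_sum (index_enum (cidx B)) d1.
have [ds2 E2] := is_diff_sum (index_enum (cidx B)) d2.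
rewrite (deriveE h ds1) E1.
have E3 := etrans (deriveE ('D_h p y) ds2) (congr1 (fun d => d ('D_h p y)) E2).
have E4 := derive_coordinates B ('D_h c y) (df _ Apy).
apply: (etrans _ (esym (congr2 +%R E3 E4))).
by rewrite -big_split (deriveE h dc) (deriveE h dp).
Qed.

(** Reduced to the scalar case through the coordinates of [F]; it is needed for transition maps,
    which are vector valued. *)
Lemma derive_swap_coordinates V F (C : coordinates F) (f : V -> F) (A : set V)
  (x u v : V) : open A -> A x -> Ck 2 A f ->
  'D_u (fun y => 'D_v f y) x = 'D_v (fun y => 'D_u f y) x.
Proof.
move=> oA Ax fA.
have h (a : cidx C) s t : cof a ('D_s (fun y => 'D_t f y) x) =
    'D_s (fun y => 'D_t (fun z => cof a (f z)) y) x.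
  case: fA => df fA.
  rewrite -(derive_selfderiv_comp _ (cof_selfderiv a)); last first.
    by case: (fA t) => d _; exact: d.
  apply: near_eq_derive; apply: (near_open oA Ax) => y Ay /=.
  by rewrite -(derive_selfderiv_comp _ (cof_selfderiv a)); last exact: df.
rewrite [LHS](cof_sum C) [RHS](cof_sum C); apply: eq_bigr => a _.
apply: (congr1 (fun s => s *: cvec a)).
apply: (etrans (h a u v)); apply: (etrans _ (esym (h a v u))).
have caA : Ck 2 A (fun z => cof a (f z)).
  exact: (Ck_selfderiv_comp oA (cof_selfderiv a) fA).
exact: (derive_swap u v oA Ax caA).
Qed.

End DirectionalFields.

(** * The Euler-Lagrange operator in coordinates *)

Section LocalEulerLagrange.
Context (R : realType) (n : nat).
Local Notation E := 'rV[R]_n.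
Local Notation EE := (E * E)%type.

Let BE := row_coordinates R n.
Let BEE := prod_coordinates BE BE.

(* In natural coordinates [(x, v)], the function [el l y (v, f) w] is
   [w^b ((v^a d/dx^a + f^a d/dv^a) (dl/dv^b) - dl/dx^b)]. *)
Definition el (l : EE -> R) (y g : EE) (w : E) : R :=
  'D_g (fun z => 'D_((0, w) : EE) l z) y - 'D_((w, 0) : EE) l y.

Lemma derive_split (l : EE -> R) (y : EE) (a b : E) : differentiable l y ->
  'D_((a, b) : EE) l y = 'D_((a, 0) : EE) l y + 'D_((0, b) : EE) l y.
Proof.
move=> dl; have -> : (a, b) = (a, 0) + (0, b) :> EE.
  by rewrite /GRing.add /= /add_pair /= addr0 add0r.
by rewrite !deriveE// linearD.
Qed.

(** By [derive_field], differentiating the vertical lift produces an extra derivative of [l] along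
    [(0, 'D_(g.1) z y.1)]. The fibre part of the complete lift produces the same term, and the two
    cancel. *)
Lemma el_field (A : set EE) (l : EE -> R) (z : E -> E) (y g : EE) :
  open A -> A y -> Ck 2 A l -> differentiable z y.1 ->
  'D_g (fun y => 'D_((0, z y.1) : EE) l y) y
    - 'D_((z y.1, 'D_(g.1) z y.1) : EE) l y = el l y g (z y.1).
Proof.
move=> oA Ay lA dz; have dl : differentiable l y by case: lA => d _; exact: d.
have dz' : is_diff y (fun y : EE => (0 : E, z y.1))
    (fun h : EE => (0, 'd z (y.1) h.1)).
  apply: is_diff_inr.
  by apply: is_diff_comp; [exact: selfderiv_fst|exact: differentiableP].
have [d1 E1] := dz'.
have := @derive_field _ _ _ _ BEE A A l (fun y : EE => (0, z y.1)) id y g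
  oA oA (fun _ => id) Ay lA d1 (ex_diff (is_diff_def := selfderiv_id y)).
rewrite derive_id (deriveE g d1) E1 -(deriveE (g.1) dz) => Eg.
apply: (etrans (congr2 (fun a b => a - b) Eg (derive_split _ _ dl))).
by rewrite opprD [- _ - _]addrC addrA addrK.
Qed.

(** The tangent map of [p] in natural coordinates; for a transition map of the base it is the
    transition map of the tangent bundle ([ttransition]). *)
Definition tlift (p : E -> E) (y : EE) : EE := (p y.1, 'D_(y.2) p y.1).

Lemma open_fst (W : set E) : open W -> open [set y : EE | W y.1].
Proof. by move=> oW; apply: open_comp => // y _; exact: cvg_fst. Qed.

Lemma Ck_tlift k (W : set E) (p : E -> E) : open W -> Ck k.+1 W p ->
  Ck k [set y : EE | W y.1] (tlift p).
Proof.
move=> oW pW; have oW' := open_fst oW.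
have f1 : Ck k [set y : EE | W y.1] fst by exact: Ck_selfderiv (@selfderiv_fst _ _ _).
have f2 : Ck k [set y : EE | W y.1] snd by exact: Ck_selfderiv (@selfderiv_snd _ _ _).
apply: Ck_pair => //; first exact: (Ck_comp BE oW' _ f1 (CkS pW)).
exact: (Ck_derive_field BE oW' oW).
Qed.

Lemma derive_tlift (W : set E) (p : E -> E) (y g : EE) : open W -> W y.1 ->
  Ck 2 W p -> 'D_g (tlift p) y =
  ('D_(g.1) p y.1, 'D_(g.1) (fun x => 'D_(y.2) p x) y.1 + 'D_(g.2) p y.1).
Proof.
move=> oW Wy pW; have oW' := open_fst oW.
have dp : differentiable p y.1 by case: pW => d _; exact: d.
have [f1 F1] := @selfderiv_fst R E E y.
have [f2 F2] := @selfderiv_snd R E E y.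
have [d2 _] : Ck 1 [set y : EE | W y.1] (fun y => 'D_(y.2) p y.1).
  apply: (Ck_derive_field BE oW' oW) => //; apply: Ck_selfderiv.
    exact: selfderiv_snd.
  exact: selfderiv_fst.
have d1 : differentiable (p \o fst) y by exact: differentiable_comp.
have -> : 'D_g (tlift p) y =
    ('D_g (p \o fst) y, 'D_g (fun y : EE => 'D_(y.2) p y.1) y).
  exact: (derive_pairE g d1 (d2 y Wy)).
rewrite (derive_compE g f1 dp) (deriveE g f1) F1.
congr (_, _).
apply: (etrans (@derive_field _ _ _ _ BE _ W p snd fst y g oW' oW
  (fun _ => id) Wy pW f2 f1)).
exact: (congr2 (fun a b : E => 'D_a (fun x => 'D_(y.2) p x) y.1 + 'D_b p y.1)
  (selfderiv_derive y g (@selfderiv_fst R E E))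
  (selfderiv_derive y g (@selfderiv_snd R E E))).
Qed.

(** Chart invariance. Both terms of [el l'] acquire a derivative of [l] along a vertical vector made
    of second derivatives of [p]; by symmetry, and because [g.1 = y.2], these vectors are equal and
    the terms cancel. *)
Lemma el_change (W : set E) (A : set EE) (p : E -> E) (l l' : EE -> R)
    (y g : EE) (w : E) :
  open W -> W y.1 -> Ck 2 W p -> open A -> Ck 2 A l ->
  (forall z, W z.1 -> A (tlift p z)) ->
  (forall z, W z.1 -> l' z = l (tlift p z)) ->
  g.1 = y.2 ->
  el l' y g w = el l (tlift p y) ('D_g (tlift p) y) ('D_w p y.1).
Proof.
move=> oW Wy pW oA lA WA l'E gy; have oW' := open_fst oW.
have dl z : A z -> differentiable l z by case: lA => d _; exact: d.
have dt z : W z.1 -> differentiable (tlift p) z.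
  by move=> Wz; case: (Ck_tlift (k := 1) oW pW) => d _; exact: d.
have dl' z h : W z.1 -> 'D_h l' z = 'D_('D_h (tlift p) z) l (tlift p z).
  move=> Wz; rewrite -derive_compE//; [|exact: dt|by apply: dl; exact: WA].
  by apply: near_eq_derive; apply: (near_open oW' Wz) => t /l'E.
have dpw : differentiable (fun x => 'D_w p x) y.1.
  by case: pW => _ /(_ w) [d _]; exact: d.
have dc : is_diff y (fun z : EE => (0 : E, 'D_w p z.1))
    (fun h : EE => (0, 'd (fun x => 'D_w p x) (y.1) h.1)).
  apply: is_diff_inr.
  by apply: (@is_diff_comp _ _ _ _ _ _ (fun x => 'D_w p x));
    [exact: selfderiv_fst|exact: differentiableP].
have [dc1 dc2] := dc.
have T0 z : W z.1 -> 'D_((0, w) : EE) (tlift p) z = (0, 'D_w p z.1).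
  by move=> Wz; rewrite (derive_tlift _ oW Wz pW) /= !derive0 add0r.
have E0 : 'D_g (fun z => 'D_((0, w) : EE) l' z) y =
    'D_g (fun z => 'D_((0, 'D_w p z.1) : EE) l (tlift p z)) y.
  apply: near_eq_derive; apply: (near_open oW' Wy) => z Wz.
  exact: (etrans (dl' z _ Wz) (congr1 (fun u => 'D_u l (tlift p z)) (T0 z Wz))).
have Ec : 'D_g (fun z : EE => (0 : E, 'D_w p z.1)) y =
    (0, 'D_(y.2) (fun x => 'D_w p x) y.1).
  by rewrite (deriveE g dc1) dc2 gy (deriveE _ dpw).
have Eg := @derive_field _ _ _ _ BEE _ A l (fun z : EE => (0 : E, 'D_w p z.1))
  (tlift p) y g oW' oA WA Wy lA dc1 (dt y Wy).
(* The vertical part first appears with the two differentiations in the other order; the swap makes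
   it the vector found in [Ec]. *)
have Tw : 'D_((w, 0) : EE) (tlift p) y =
    ('D_w p y.1, 'D_(y.2) (fun x => 'D_w p x) y.1).
  rewrite (derive_tlift (w, 0) oW Wy pW).
  rewrite [X in _ + X](derive0 p y.1) addr0.
  exact: (congr1 (pair _) (derive_swap_coordinates BE w y.2 oW Wy pW)).
have Ew := etrans (dl' y (w, 0) Wy) (etrans
  (congr1 (fun u => 'D_u l (tlift p y)) Tw) (derive_split _ _ (dl _ (WA _ Wy)))).
have Eg' := etrans (etrans E0 Eg) (congr1 (fun u => _ + 'D_u l (tlift p y)) Ec).
apply: (etrans (congr2 (fun a b => a - b) Eg' Ew)).
by rewrite opprD [- _ - _]addrC addrA addrK.
Qed.

End LocalEulerLagrange.

(** * The linear system for the acceleration in a chart *)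

Section LocalSolution.
Context (R : realType) (n : nat).
Local Notation E := 'rV[R]_n.
Local Notation EE := (E * E)%type.

Let BE := row_coordinates R n.
Let BEE := prod_coordinates BE BE.

(** Linearity in the vertical direction holds at all points near [y], hence survives the derivative
    along [g]. The codomain is [R^o] so that a linear form can be built from it. *)
Lemma el_linear (A : set EE) (l : EE -> R) (y g : EE) :
  open A -> A y -> Ck 2 A l -> linear (el l y g : E -> R^o).
Proof.
move=> oA Ay [dl l2A] a w w'.
have pE (u u' : E) : (0, a *: u + u') = a *: (0, u) + (0, u') :> EE.
  by rewrite /GRing.add /GRing.scale /= /add_pair /scale_pair /= scaler0 addr0.
have pE' (u u' : E) : (a *: u + u', 0) = a *: (u, 0) + (u', 0) :> EE.
  by rewrite /GRing.add /GRing.scale /= /add_pair /scale_pair /= scaler0 addr0.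
have dd (u : EE) : differentiable (fun z => 'D_u l z) y.
  by case: (l2A u) => d _; exact: d.
have Eg : 'D_g (fun z => 'D_((0, a *: w + w') : EE) l z) y =
   a * 'D_g (fun z => 'D_((0, w) : EE) l z) y
   + 'D_g (fun z => 'D_((0, w') : EE) l z) y.
  have dZ : differentiable (a \*: (fun z => 'D_((0, w) : EE) l z)) y.
    exact: differentiableZ.
  have E1 : 'D_g (fun z => 'D_((0, a *: w + w') : EE) l z) y =
     'D_g ((a \*: (fun z => 'D_((0, w) : EE) l z))
           + (fun z => 'D_((0, w') : EE) l z)) y.
    apply: near_eq_derive; apply: (near_open oA Ay) => z Az.
    by rewrite pE (derive_linear (dl z Az)).
  have h1 := diff_derivable (v := g) dZ; have h2 := diff_derivable (v := g) (dd (0, w')).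
  apply: (etrans E1); apply: (etrans (deriveD h1 h2)).
  apply: (congr1 (fun x => x + _)).
  exact: (deriveZ _ (diff_derivable (v := g) (dd (0, w)))).
have Ew : 'D_((a *: w + w', 0) : EE) l y =
    a * 'D_((w, 0) : EE) l y + 'D_((w', 0) : EE) l y.
  by rewrite pE' (derive_linear (dl y Ay)).
apply: (etrans (congr2 (fun a b => a - b) Eg Ew)).
have alg (p q r s : R) : a * p + q - (a * r + s) = a * (p - r) + (q - s).
  by ring.
exact: alg.
Qed.

Definition el_hessian (l : EE -> R) (y : EE) : 'M[R]_n :=
  \matrix_(a < n, b < n) du (du l b) a y.

(** The opposite of the part of [el] free of the acceleration: [dl/dx^b - v^a d^2 l/dx^a dv^b]. *)
Definition el_force (l : EE -> R) (y : EE) : E :=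
  \row_(b < n) ('D_((delta_mx 0 b, 0) : EE) l y
    - 'D_((y.2, 0) : EE) (fun z => 'D_((0, delta_mx 0 b) : EE) l z) y).

Definition el_accel (l : EE -> R) (y : EE) : E :=
  el_force l y *m invmx (el_hessian l y).

Lemma derive_vertical (f : EE -> R) (y : EE) (w : E) : differentiable f y ->
  'D_((0, w) : EE) f y = \sum_a w 0 a * 'D_((0, delta_mx 0 a) : EE) f y.
Proof.
move=> df; rewrite (derive_coordinates BEE _ df) big_sumType /=.
rewrite [X in X + _]big1; first exact: add0r.
by move=> a _; rewrite mxE; exact: scale0r.
Qed.

(** Splitting [(v, f)] into horizontal and vertical parts shows that, on basis vectors, the equation
    [el = 0] is the linear system [f *m H = force], with [H] the velocity Hessian. *)
Lemma el_delta (A : set EE) (l : EE -> R) (y : EE) (f : E) (b : 'I_n) :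
  A y -> Ck 2 A l -> el l y (y.2, f) (delta_mx 0 b) =
  (f *m el_hessian l y - el_force l y) 0 b.
Proof.
move=> Ay [dl l2A].
have dd : differentiable (fun z => 'D_((0, delta_mx 0 b) : EE) l z) y.
  by case: (l2A (0, delta_mx 0 b)) => d _; exact: d.
rewrite !mxE /el (derive_split _ _ dd) (derive_vertical _ dd).
have -> : \sum_j f 0 j * el_hessian l y j b =
    \sum_a f 0 a * 'D_((0, delta_mx 0 a) : EE)
      (fun z => 'D_((0, delta_mx 0 b) : EE) l z) y.
  by apply: eq_bigr => a _; rewrite mxE.
have alg (p q r : R) : p + q - r = q - (r - p) by ring.
exact: alg.
Qed.

(** Testing on basis vectors gives the linear system, which the invertible Hessian solves uniquely;
    conversely [el_linear] extends vanishing from basis vectors to all [w]. *)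
Lemma el_eq0P (A : set EE) (l : EE -> R) (y g : EE) :
  open A -> A y -> Ck 2 A l -> el_hessian l y \in unitmx -> g.1 = y.2 ->
  (forall w, el l y g w = 0) <-> g = (y.2, el_accel l y).
Proof.
move=> oA Ay lA Hu; case: g => v f /= ->; split => [el0|[->] w].
  congr (_, _); apply: (canRL (mulmxK Hu)); apply/eqP; rewrite -subr_eq0.
  by apply/eqP/rowP => b; rewrite -(el_delta _ _ Ay lA) el0 mxE.
pose L := GRing.isLinear.Build R E R^o _ _ (el_linear (y.2, el_accel l y) oA Ay lA).
pose f' : {linear E -> R^o} := HB.pack (el l y (y.2, el_accel l y) : E -> R^o) L.
rewrite -[LHS]/(f' w) (row_sum_delta w) linear_sum big1// => b _.
rewrite linearZ /= (el_delta _ _ Ay lA) /el_accel mulmxKV// subrr mxE.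
by rewrite scaler0.
Qed.

Lemma Ck_det m (V : normedModType R) k (A : set V) (M : V -> 'M[R]_m) : open A ->
  (forall i j, Ck k A (fun y => M y i j)) -> Ck k A (fun y => \det (M y)).
Proof.
move=> oA MA; apply: Ck_sum => // s; apply: CkM => //; first exact: Ck_cst.
by apply: Ck_prod => // i; exact: MA.
Qed.

(** Cramer's rule: each entry is a cofactor, with transposed indices, over the determinant. *)
Lemma Ck_invmx m (V : normedModType R) k (A : set V) (M : V -> 'M[R]_m) i j :
  open A -> (forall y, A y -> M y \in unitmx) ->
  (forall i j, Ck k A (fun y => M y i j)) -> Ck k A (fun y => invmx (M y) i j).
Proof.
move=> oA Mu MA.
apply: (@Ck_eq _ _ _ _ _ (fun y => (\det (M y))^-1 *
    ((-1) ^+ (j + i) * \det (row' j (col' i (M y))))) _ oA).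
  by move=> y Ay; rewrite /invmx Mu// !mxE.
apply: CkM => //.
  apply: CkV => //; first by move=> y Ay; rewrite -unitfE; exact: Mu.
  exact: Ck_det.
apply: CkM => //; first exact: Ck_cst.
apply: Ck_det => // a b.
by apply: (@Ck_eq _ _ _ _ _ (fun y => M y (lift j a) (lift i b)) _ oA) => [y _|];
  [rewrite !mxE|exact: MA].
Qed.

Lemma Ck_el_accel k (A : set EE) (l : EE -> R) : open A -> Ck k.+2 A l ->
  (forall y, A y -> el_hessian l y \in unitmx) -> Ck k A (el_accel l).
Proof.
move=> oA lA Hu.
have l1 (u : EE) : Ck k.+1 A (fun y => 'D_u l y) by case: lA => _; exact.
have l2 (u v : EE) : Ck k A (fun y => 'D_u (fun z => 'D_v l z) y).
  by case: (l1 v) => _; exact.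
apply: (@Ck_coordinates _ _ _ BE) => // b.
apply: (@Ck_eq _ _ _ _ _ (fun y => \sum_c el_force l y 0 c *
   invmx (el_hessian l y) c b) _ oA) => [y _|]; first by rewrite /= mxE.
apply: Ck_sum => // c; apply: CkM => //.
  apply: (@Ck_eq _ _ _ _ _ (fun y => 'D_((delta_mx 0 c, 0) : EE) l y
    - 'D_((y.2, 0) : EE) (fun z => 'D_((0, delta_mx 0 c) : EE) l z) y) _ oA).
    by move=> y _; rewrite mxE.
  apply: CkB => //; first exact: CkS (l1 _).
  (* The direction [(y.2, 0)] depends on the point, so membership of [l] in C^(k+2) does not give
     this term directly. *)
  apply: (Ck_derive_field BEE oA oA (fun _ => id)) => //.
  - apply: Ck_pair => //; last exact: Ck_cst.
    exact: Ck_selfderiv (@selfderiv_snd _ _ _).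
  - exact: Ck_selfderiv (@selfderiv_id _ _).
apply: Ck_invmx => // i j.
by apply: (@Ck_eq _ _ _ _ _ (fun y => 'D_((0, delta_mx 0 i) : EE)
  (fun z => 'D_((0, delta_mx 0 j) : EE) l z) y) _ oA) => [y _|]; [rewrite mxE|].
Qed.

End LocalSolution.

(** * Changes of chart *)

Section Atlas.
Context (R : realType) (M : Type) (E : normedModType R) (A : charted M E).

(** The part of [smooth_manifold] that mentions no topology on [M], so that the same chart calculus
    applies to [tangent_charts]. *)
Definition atlas : Prop :=
  [/\ forall p, dom (pref A p) p,
      forall (i : chart_ix A) p, dom i p -> param i (coord i p) = p,
      forall i j : chart_ix A, open (chart_image (dom j) i) &
      forall i j : chart_ix A,
        smooth_on (chart_image (dom j) i) (coord j \o param i)].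

Hypothesis hA : atlas.
Implicit Types i j k : chart_ix A.

Lemma chart_image_coord (U : set M) i q :
  U q -> dom i q -> chart_image U i (coord i q).
Proof. by move=> Uq iq; exists q. Qed.

Lemma near_chart i j q (P : E -> Prop) : dom i q -> dom j q ->
  (forall q', dom i q' -> dom j q' -> P (coord i q')) ->
  \forall x \near coord i q, P x.
Proof.
case: hA => _ _ oij _ iq jq HP.
apply: (near_open (oij i j) (chart_image_coord jq iq)) => x [q' [jq' iq'] <-].
exact: HP.
Qed.

Lemma differentiable_transition i j q : dom i q -> dom j q ->
  differentiable (coord j \o param i) (coord i q).
Proof.
case: hA => _ _ _ sij iq jq; case: (sij i j 1) => d _; apply: d.
exact: chart_image_coord.
Qed.

(** The chain rule through the transition map. With [f] a coordinate map it becomes the cocycle rule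
    [change_comp]. *)
Lemma derive_chart (F : normedModType R) (f : M -> F) i j q v :
  dom i q -> dom j q -> differentiable (f \o param j) (coord j q) ->
  'D_v (f \o param i) (coord i q) =
  'D_(change i j q v) (f \o param j) (coord j q).
Proof.
move=> iq jq df; have [_ pK _ _] := hA.
have Ef : 'D_v (f \o param i) (coord i q) =
    'D_v ((f \o param j) \o (coord j \o param i)) (coord i q).
  apply: near_eq_derive; apply: (near_chart iq jq) => q' iq' jq' /=.
  by rewrite !pK.
have cE : (coord j \o param i) (coord i q) = coord j q by rewrite /= pK.
have df' : differentiable (f \o param j) ((coord j \o param i) (coord i q)).
  by rewrite cE.
apply: (etrans Ef).
apply: (etrans (derive_compE v (differentiable_transition iq jq) df')).
by rewrite cE.
Qed.

Lemma change_comp i j k q v : dom i q -> dom j q -> dom k q ->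
  change j k q (change i j q v) = change i k q v.
Proof.
move=> iq jq kq; apply: esym.
exact: (derive_chart v iq jq (differentiable_transition jq kq)).
Qed.

Lemma change_id i q v : dom i q -> change i i q v = v.
Proof.
move=> iq; have [_ pK _ _] := hA; rewrite -[RHS](derive_id (coord i q) v).
by apply: near_eq_derive; apply: (near_chart iq iq) => q' iq' _ /=; rewrite pK.
Qed.

Lemma changeK i j q v : dom i q -> dom j q ->
  change j i q (change i j q v) = v.
Proof. by move=> iq jq; rewrite change_comp// change_id. Qed.

Lemma change0 i j q : change i j q 0 = 0.
Proof. exact: derive0. Qed.

Lemma changeZ i j q (a : R) v : dom i q -> dom j q ->
  change i j q (a *: v) = a *: change i j q v.
Proof.
move=> iq jq; have := derive_linear (differentiable_transition iq jq) a v 0.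
by rewrite addr0 derive0 addr0.
Qed.

Lemma vf_loc_coord (X : M -> E) i q : dom i q ->
  vf_loc X i (coord i q) = change (pref A q) i q (X q).
Proof. by case: hA => _ pK _ _ iq; rewrite /vf_loc pK. Qed.

End Atlas.

(** * The natural charts of the tangent bundle *)

Section TangentAtlas.
Context (R : realType) (n : nat) (M : Type) (A : charted M 'rV[R]_n).
Local Notation E := 'rV[R]_n.
Local Notation EE := (E * E)%type.
Local Notation TA := (tangent_charts A).
Local Notation tcoord i := (@coord R (tangent A) EE TA i).
Local Notation tparam i := (@param R (tangent A) EE TA i).

Hypothesis hA : atlas A.
Implicit Types i j : chart_ix A.

Lemma tparamK i (p : tangent A) : dom i p.1 -> tparam i (tcoord i p) = p.
Proof.
case: p => q u /= iq; have [dp pK _ _] := hA.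
by rewrite /= pK// changeK.
Qed.

Lemma tcoordK i (z : EE) : chart_image setT i z.1 -> tcoord i (tparam i z) = z.
Proof.
case: z => x v /= [q [_ iq] <-]; have [dp pK _ _] := hA.
by rewrite /= pK// changeK.
Qed.

(** The fibre coordinate ranges over all of [E], because [change] is invertible on each fibre. *)
Lemma tchart_image (U : set M) i :
  chart_image (A := TA) (@tproj _ _ _ A @^-1` U) i = [set z | chart_image U i z.1].
Proof.
have [dp pK _ _] := hA; apply/seteqP; split=> [z [p [Up ip] <-]|z] /=.
  exact: chart_image_coord.
move=> [q [Uq iq] qz]; exists (tparam i z).
  by split; rewrite /tproj /= -qz pK.
by apply: tcoordK; exists q.
Qed.

(** The detour through the preferred chart disappears by [change_comp]. *)
Lemma ttransition i j (z : EE) : chart_image (dom j) i z.1 ->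
  tcoord j (tparam i z) = tlift (coord j \o param i) z.
Proof.
case: z => x v /= [q [jq iq] <-]; have [dp pK _ _] := hA.
rewrite /= pK// change_comp//; by rewrite /tlift /= pK.
Qed.

Lemma open_tchart_image i j : open [set z : EE | chart_image (dom j) i z.1].
Proof. by case: hA => _ _ o _; exact: open_fst. Qed.

Lemma tangent_atlas : atlas TA.
Proof.
have [dp pK oA sA] := hA; split=> [p|i p|i j|i j k].
- exact: dp.
- exact: tparamK.
- have -> := tchart_image (dom (j : chart_ix A)) (i : chart_ix A).
  exact: open_tchart_image.
- have -> := tchart_image (dom (j : chart_ix A)) (i : chart_ix A).
  apply: (@Ck_eq R EE EE k _ (tlift (coord (j : chart_ix A) \o param (i : chart_ix A)))
    _ (@open_tchart_image i j)) => [z zij|].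
    exact: esym (ttransition zij).
  exact: (Ck_tlift (oA i j) (sA i j k.+1)).
Qed.

Lemma tchangeE i j (p : tangent A) g : dom i p.1 -> dom j p.1 ->
  @change _ _ _ TA i j p g = 'D_g (tlift (coord j \o param i)) (tcoord i p).
Proof.
move=> ip jp; apply: near_eq_derive.
apply: (near_open (@open_tchart_image i j)) => [|z zij].
  exact: (chart_image_coord jp ip).
exact: ttransition.
Qed.

(** The fibre components of a tangent vector to the bundle transform with an additional
    second-derivative term; it vanishes for vertical vectors, whence [tchange_vertical]. *)
Lemma tchange_pair i j (p : tangent A) g : dom i p.1 -> dom j p.1 ->
  @change _ _ _ TA i j p g = (change i j p.1 g.1,
    'D_(g.1) (fun x => 'D_((tcoord i p).2) (coord j \o param i) x) (coord i p.1)
    + change i j p.1 g.2).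
Proof.
move=> ip jp; rewrite tchangeE//; case: hA => _ _ oA sA.
exact: (derive_tlift (y := tcoord i p) g (oA i j) (chart_image_coord jp ip) (sA i j 2)).
Qed.

Lemma tchange_vertical i j (p : tangent A) w : dom i p.1 -> dom j p.1 ->
  @change _ _ _ TA i j p (0, w) = (0, change i j p.1 w).
Proof.
move=> ip jp; rewrite tchange_pair// /= change0; congr (_, _).
by rewrite derive0 add0r.
Qed.

End TangentAtlas.

(** * Global vector fields and the Euler-Lagrange operator on the manifold *)

Section Manifold.
Context (R : realType) (n : nat) (Q : topologicalType).
Context (A : charted Q 'rV[R]_n) (hQ : smooth_manifold A).
Local Notation E := 'rV[R]_n.
Local Notation EE := (E * E)%type.
Local Notation TA := (tangent_charts A).
Local Notation tcoord i := (@coord R (tangent A) EE TA i).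
Local Notation tparam i := (@param R (tangent A) EE TA i).
Implicit Types i j : chart_ix A.

Lemma param_coord i q : dom i q -> param i (coord i q) = q.
Proof. by case: hQ => _ _ _ /(_ i)[_ _ h _ _] _ iq; apply: h; rewrite inE. Qed.

Lemma open_chart_image (U : set Q) i : open U -> open (chart_image U i).
Proof.
move=> oU; case: hQ => _ _ _ /(_ i)[_ oi _ _ cp] _.
have -> : chart_image U i = (coord i @` dom i) `&` [set x | U (param i x)].
  apply/seteqP; split=> [x [q [Uq iq] <-]|x [[q iq <-]] /=].
    by split; [exists q|rewrite /= param_coord].
  by rewrite param_coord// => Uq; exists q.
rewrite openE => x [ix Ux]; apply: filterI.
  exact: open_nbhs_nbhs.
by apply: (cp x ix); exact: open_nbhs_nbhs.
Qed.

Lemma manifold_atlas : atlas A.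
Proof.
case: (hQ) => _ _ dp hc sA; split => //; first by move=> i p; exact: param_coord.
by move=> i j; apply: open_chart_image; case: (hc j).
Qed.

Let hA : atlas A := manifold_atlas.
Let hTA : atlas TA := tangent_atlas hA.

Lemma dom_pref q : dom (pref A q) q.
Proof. by case: hA. Qed.

Lemma open_tangent_chart_image (U : set Q) i : open U ->
  open [set z : EE | chart_image U i z.1].
Proof. by move=> oU; exact: open_fst (@open_chart_image U i oU). Qed.

(** The field with constant components [w] in the preferred chart at [q] is multiplied by a bump
    function and extended by zero. *)
Lemma global_vf_exists (q : Q) (w : E) :
  exists2 Z : Q -> E, smooth_vf A setT Z & Z q = w.
Proof.
have [hausQ _ _ hc sA] := hQ.
pose i := pref A q; have iq : dom i q := dom_pref q.
have [oi oci _ _ cp] := hc i.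
have nx : nbhs (coord i q) (coord i @` dom i).
  by apply: open_nbhs_nbhs; split=> //; exists q.
have [rho [K [srho rho1 cK KW rho0]]] := bump_exists nx.
pose Z q' := if pselect (dom i q')
  then rho (coord i q') *: change i (pref A q') q' w else 0 : E.
have ZE q' : dom i q' -> Z q' = rho (coord i q') *: change i (pref A q') q' w.
  by rewrite /Z; case: pselect.
exists Z; last by rewrite ZE// rho1 scale1r (change_id hA).
(* The image of the compact set is compact, hence closed as [Q] is Hausdorff. So [K'] is open, and
   together with [dom i] it covers [Q]; smoothness is checked on each. *)
pose K' := ~` (param i @` K).
have oK' : open K'.
  apply: closed_openC; apply: compact_closed => //; apply: continuous_compact => //.
  by apply: continuous_in_subspaceT => x /set_mem /KW; exact: cp.
move=> j k.
apply: (@Ck_sub _ _ _ _ (chart_image (dom i) j `|` chart_image K' j)).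
  move=> x [q' [_ jq'] <-]; have [iq'|iq'] := pselect (dom i q').
    by left; exact: chart_image_coord.
  right; apply: chart_image_coord => //= -[y /KW [q'' iq'' <-]].
  by rewrite param_coord// => qq; apply: iq'; rewrite -qq.
have oi' := @open_chart_image _ j oi.
have oK'' := @open_chart_image _ j oK'.
have sij : smooth_on (chart_image (dom i) j) (coord i \o param j) by exact: sA.
have sji : smooth_on (chart_image (dom j) i) (coord j \o param i) by exact: sA.
have BE := row_coordinates R n.
apply: CkU.
  (* On [dom i], the expression of the field in chart [j] is the bump function times the derivative
     along [w] of the transition from [i] to [j]. *)
  apply: (@Ck_eq _ _ _ _ _ (fun x => rho ((coord i \o param j) x) *:
     'D_w (coord j \o param i) ((coord i \o param j) x)) _ oi').
    move=> x [q' [iq' jq'] <-].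
    have -> : (coord i \o param j) (coord j q') = coord i q'.
      by rewrite /= param_coord.
    rewrite (vf_loc_coord hA _ jq') ZE//.
    apply: esym; apply: (etrans (changeZ hA _ _ (dom_pref q') jq')).
    apply: (congr1 (fun v => rho (coord i q') *: v)).
    exact: (change_comp hA _ iq' (dom_pref q') jq').
  apply: Ck_scale => //.
    exact: (Ck_comp BE (A' := setT) oi' _ (sij k) (srho k)).
  have sd : Ck k (chart_image (dom j) i) (fun y => 'D_w (coord j \o param i) y).
    by case: (sji k.+1) => _; exact.
  refine (Ck_comp BE oi' _ (sij k) sd).
  move=> x [q' [iq' jq'] <-] /=; rewrite param_coord//.
  exact: chart_image_coord.
apply: (@Ck_eq _ _ _ _ _ (fun x => 0 : E) _ oK''); last exact: Ck_cst.
move=> x [q' [Kq' jq'] <-]; rewrite (vf_loc_coord hA _ jq').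
suff -> : Z q' = 0 by rewrite change0.
have [iq'|iq'] := pselect (dom i q'); last by rewrite /Z; case: pselect.
rewrite ZE// rho0 ?scale0r// => Kx; apply: Kq'; exists (coord i q') => //.
exact: param_coord.
Qed.

Variable L : tangent A -> R.
Hypothesis hL : smooth_fun TA setT L.

Local Notation lag i := (L \o tparam i).

Let tdom i : set EE := [set z | chart_image setT i z.1].

Let open_tdom i : open (tdom i).
Proof. exact: open_tangent_chart_image openT. Qed.

Lemma smooth_lagrangian i : smooth_on (tdom i) (lag i).
Proof. by move=> k; have := hL (i : chart_ix TA) k; rewrite (tchart_image hA setT i). Qed.

Let tdom_coord i (p : tangent A) : dom i p.1 -> tdom i (tcoord i p).
Proof. exact: chart_image_coord. Qed.

Lemma tcoord_pref (p : tangent A) :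
  tcoord (pref A p.1) p = (coord (pref A p.1) p.1, p.2).
Proof. by rewrite /= (change_id hA)//; exact: dom_pref. Qed.

(** [vf_app] uses the preferred chart, which changes from point to point. A fixed chart is needed
    before the function can be differentiated again. *)
Lemma vertical_lift_lag (Z : Q -> E) i (p : tangent A) : dom i p.1 ->
  vf_app TA (vertical_lift Z) L p =
  'D_((0, vf_loc Z i (tcoord i p).1) : EE) (lag i) (tcoord i p).
Proof.
move=> ip; have pp := dom_pref p.1.
have dl : differentiable (lag i) (tcoord i p).
  by case: (smooth_lagrangian i 1) => d _; apply: d; exact: tdom_coord.
apply: (etrans (derive_chart hTA (i := pref A p.1 : chart_ix TA)
  (j := i : chart_ix TA) (q := p) (vertical_lift Z p) pp ip dl)).
apply: (congr1 (fun u => 'D_u (lag i) (tcoord i p))).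
apply: (etrans (tchange_vertical hA (Z p.1) pp ip)).
by apply: (congr1 (pair 0)); rewrite (vf_loc_coord hA).
Qed.

(** This is [el_field] in the preferred chart at [p]; the second-order condition makes the direction
    [p.2] in the complete lift equal to [(G p).1]. *)
Lemma euler_lagrangeE (U : set Q) (Z : Q -> E) (G : tangent A -> EE)
    (p : tangent A) : open U -> smooth_vf A U Z -> U p.1 -> (G p).1 = p.2 ->
  euler_lagrange L G Z p =
  el (lag (pref A p.1)) (tcoord (pref A p.1) p) (G p) (Z p.1).
Proof.
move=> oU sZ Up Gp; set i := pref A p.1; have ip : dom i p.1 := dom_pref p.1.
have dz : differentiable (vf_loc Z i) (tcoord i p).1.
  by case: (sZ i 1) => d _; apply: d; exact: chart_image_coord.
have Zp : vf_loc Z i (tcoord i p).1 = Z p.1.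
  by rewrite (vf_loc_coord hA)// (change_id hA).
have el_i := el_field (G p) (@open_tdom i) (tdom_coord ip) (smooth_lagrangian i 2) dz.
have cE : complete_lift Z p =
    (vf_loc Z i (tcoord i p).1, 'D_((G p).1) (vf_loc Z i) (tcoord i p).1).
  by rewrite Zp Gp.
apply: (etrans _ (etrans el_i (congr1 (el (lag i) (tcoord i p) (G p)) Zp))).
apply: (congr2 (fun a b => a - b) _ (congr1 (fun u => 'D_u (lag i) (tcoord i p)) cE)).
(* What remains is to compute the vertical lift in the one chart [i] at all points near [p]. *)
apply: near_eq_derive; apply: (near_open (@open_tdom i) (tdom_coord ip)) => z zi.
have zK : tcoord i (tparam i z) = z by exact: (tcoordK hA).
have iz : dom i (tparam i z).1.
  by case: zi => q [_ iq] zq; rewrite /= -zq param_coord.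
by have := vertical_lift_lag Z iz; rewrite zK; apply.
Qed.

End Manifold.

(** * The Euler-Lagrange field: smoothness, equations, pointwise uniqueness *)

Section EulerLagrangeField.
Context (R : realType) (n : nat) (Q : topologicalType).
Context (A : charted Q 'rV[R]_n) (hQ : smooth_manifold A).
Local Notation E := 'rV[R]_n.
Local Notation EE := (E * E)%type.
Local Notation TA := (tangent_charts A).
Local Notation tcoord i := (@coord R (tangent A) EE TA i).
Local Notation tparam i := (@param R (tangent A) EE TA i).
Implicit Types i j : chart_ix A.

Let hA : atlas A := manifold_atlas hQ.

Variable L : tangent A -> R.
Hypothesis hL : smooth_fun TA setT L.
Hypothesis hreg : regular L.

Local Notation lag i := (L \o tparam i).
Local Notation tdom i := [set z : EE | chart_image (A := A) setT i z.1].

(** In natural coordinates the projection is [fst]. The second-order condition therefore reads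
    [(G p).1 = p.2], as extracted in [sode_fst]. *)
Lemma tangent_map_tproj (p : tangent A) (v : EE) :
  tangent_map TA A (@tproj _ _ _ A) p v = v.1.
Proof.
have ip := dom_pref hQ p.1; set i := pref A p.1.
apply: (etrans _ (selfderiv_derive (tcoord i p) v (@selfderiv_fst _ _ _))).
apply: near_eq_derive.
apply: (near_open (@open_tangent_chart_image _ _ _ _ hQ setT i openT)).
  exact: chart_image_coord.
move=> z [q [_ iq] zq]; rewrite -zq /= /tproj /= -/i.
by rewrite -zq (param_coord hQ iq).
Qed.

(** Defined pointwise in preferred charts, which may jump; smoothness comes from
    [euler_lagrange_field_loc]. *)
Definition euler_lagrange_field (p : tangent A) : EE :=
  (p.2, el_accel (lag (pref A p.1)) (tcoord (pref A p.1) p)).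

Let tdom_coord i (p : tangent A) : dom i p.1 -> tdom i (tcoord i p).
Proof. exact: chart_image_coord. Qed.

Let open_tdom i : open (tdom i).
Proof. exact: (open_tangent_chart_image hQ openT). Qed.

Lemma euler_lagrange_fieldP (p : tangent A) (g : EE) : g.1 = p.2 ->
  (forall w, el (lag (pref A p.1)) (tcoord (pref A p.1) p) g w = 0) <->
  g = euler_lagrange_field p.
Proof.
move=> gp; have ip := dom_pref hQ p.1.
have := el_eq0P (@open_tdom _) (tdom_coord ip) (smooth_lagrangian hQ hL _ 2)
  (hreg ip).
rewrite /euler_lagrange_field (tcoord_pref hQ p) /=; exact.
Qed.

Lemma el_hessian_unit i (z : EE) : chart_image (A := A) setT i z.1 ->
  el_hessian (lag i) z \in unitmx.
Proof.
move=> zi; have zp : tcoord i (tparam i z) = z := tcoordK hA zi.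
have ip : dom i (tparam i z).1.
  by case: zi => q [_ iq] zq; rewrite /= -zq (param_coord hQ).
by have := hreg ip; rewrite /velocity_hessian zp.
Qed.

Lemma el_euler_lagrange_field (p : tangent A) w :
  el (lag (pref A p.1)) (tcoord (pref A p.1) p) (euler_lagrange_field p) w = 0.
Proof.
exact: ((@euler_lagrange_fieldP p (euler_lagrange_field p) erefl).2 erefl w).
Qed.

(** The form [el] vanishes in the preferred chart, hence in chart [i] by [el_change]; uniqueness of
    the local solution in [el_eq0P] then gives the formula. *)
Lemma euler_lagrange_field_loc i (z : EE) : chart_image setT i z.1 ->
  vf_loc (A := TA) euler_lagrange_field i z = (z.2, el_accel (lag i) z).
Proof.
move=> zi; set p := tparam i z.
have zp : tcoord i p = z := tcoordK hA zi.
have ip : dom i p.1.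
  by case: zi => q [_ iq] zq; rewrite /p /= -zq (param_coord hQ).
set j := pref A p.1; have jp : dom j p.1 := dom_pref hQ p.1.
have [_ _ oA sA] := hA.
have ploc : vf_loc (A := TA) euler_lagrange_field i z =
  @change _ _ _ TA j i p (euler_lagrange_field p) by [].
have loc1 : (vf_loc (A := TA) euler_lagrange_field i z).1 = z.2.
  rewrite ploc (tchange_pair hA _ jp ip) /=.
  by rewrite -[in RHS]zp.
have tl : tlift (coord i \o param j) (tcoord j p) = z.
  rewrite -(ttransition hA); last exact: (chart_image_coord ip jp).
  exact: (etrans (congr1 (tcoord i) (tparamK hA jp)) zp).
have Wlag y : chart_image (dom i) j y.1 -> tdom i (tlift (coord i \o param j) y).
  move=> [q [iq jq] qy]; exists q; first by [].
  by rewrite /tlift /= -qy (param_coord hQ).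
have lagE y : chart_image (dom i) j y.1 ->
    lag j y = lag i (tlift (coord i \o param j) y).
  move=> yij; rewrite -(ttransition hA yij).
  have iy : dom i (tparam j y).1.
    by case: (yij) => q [iq jq] qy; rewrite /= -qy (param_coord hQ).
  exact: (congr1 L (esym (tparamK hA iy))).
(* Each [w'] in chart [i] is the image of [change i j p.1 w'] from the preferred chart [j]. *)
have el_i w' : el (lag i) z (vf_loc (A := TA) euler_lagrange_field i z) w' = 0.
  have gp : (euler_lagrange_field p).1 = (tcoord j p).2.
    by rewrite (tcoord_pref hQ p).
  have E0 := el_euler_lagrange_field p (change i j p.1 w').
  have E1 := el_change (y := tcoord j p) (change i j p.1 w') (oA j i)
    (chart_image_coord ip jp) (sA j i 2) (@open_tdom i)
    (smooth_lagrangian hQ hL i 2) Wlag lagE gp.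
  have E2 := esym (tchangeE hA (euler_lagrange_field p) jp ip).
  have E3 := changeK hA w' ip jp.
  apply: (etrans _ E0); apply: esym; apply: (etrans E1).
  exact: (etrans (congr1 (fun y => el (lag i) y _ _) tl)
    (congr2 (el (lag i) z) E2 E3)).
exact: (el_eq0P (@open_tdom i) zi (smooth_lagrangian hQ hL i 2)
  (el_hessian_unit zi) loc1).1.
Qed.

Lemma sode_euler_lagrange_field : sode setT euler_lagrange_field.
Proof.
split=> [i k|p _]; last exact: tangent_map_tproj.
rewrite (tchart_image hA setT i).
apply: (@Ck_eq _ _ _ _ _ (fun z => (z.2, el_accel (lag i) z)) _ (@open_tdom i)).
  by move=> z zi; rewrite euler_lagrange_field_loc.
apply: Ck_pair => //; first exact: Ck_selfderiv (@selfderiv_snd _ _ _).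
apply: Ck_el_accel => //; first exact: smooth_lagrangian.
by move=> z zi; exact: el_hessian_unit.
Qed.

Lemma sode_fst (U : set Q) (G : tangent A -> EE) (p : tangent A) :
  sode U G -> U p.1 -> (G p).1 = p.2.
Proof. by move=> [_ sG] Up; rewrite -(sG p Up) tangent_map_tproj. Qed.

Lemma euler_lagrange_field0 (U : set Q) (Z : Q -> E) (p : tangent A) :
  open U -> smooth_vf A U Z -> U p.1 ->
  euler_lagrange L euler_lagrange_field Z p = 0.
Proof.
move=> oU sZ Up.
rewrite (@euler_lagrangeE _ _ _ _ hQ _ hL U Z euler_lagrange_field p oU sZ Up erefl).
exact: el_euler_lagrange_field.
Qed.

(** The kernel of the linear form [el] contains a spanning family, so the form is zero. Being
    pointwise in [p] and general in the family, this serves both for frames and for global fields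
    chosen at a given point. *)
Lemma euler_lagrange_field_unique (U : set Q) (I : finType) (X : I -> Q -> E)
    (G : tangent A -> EE) (p : tangent A) :
  open U -> sode U G -> U p.1 -> (forall a, smooth_vf A U (X a)) ->
  (<<[seq X a p.1 | a : I]>> = fullv)%VS ->
  (forall a, euler_lagrange L G (X a) p = 0) ->
  G p = euler_lagrange_field p.
Proof.
move=> oU sG Up sX spX elX; have Gp := sode_fst sG Up.
apply/(euler_lagrange_fieldP Gp) => w.
have ip := dom_pref hQ p.1.
have li := el_linear (G p) (@open_tdom _) (tdom_coord ip)
  (smooth_lagrangian hQ hL (pref A p.1) 2).
pose f := el (lag (pref A p.1)) (tcoord (pref A p.1) p) (G p) : E -> R^o.
pose fM := GRing.isLinear.Build R E R^o _ f li.
pose f' : {linear E -> R^o} := HB.pack f fM.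
have : (<<[seq X a p.1 | a : I]>> <= lker (linfun f'))%VS.
  apply/span_subvP => v /mapP[a _ ->]; rewrite memv_ker lfunE /=.
  by rewrite /f -(euler_lagrangeE hQ hL oU (sX a) Up Gp) elX.
by rewrite spX => /subvP/(_ w (memvf w)); rewrite memv_ker lfunE => /eqP.
Qed.

End EulerLagrangeField.

(** * Existence, uniqueness and determination by a frame *)

Theorem proposition1 (R : realType) (n : nat) (Q : topologicalType)
    (A : charted Q 'rV[R]_n) (hQ : smooth_manifold A)
    (L : tangent A -> R)
    (hL : smooth_fun (tangent_charts A) setT L) (hreg : regular L) :
  let solution (G : tangent A -> ('rV[R]_n * 'rV[R]_n)%type) :=
    sode setT G /\
    (forall Z : Q -> 'rV[R]_n, smooth_vf A setT Z ->
       forall p : tangent A, euler_lagrange L G Z p = 0) in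
  (exists! G, solution G) /\
  (forall G, solution G ->
     forall (U : set Q) (X : 'I_n -> Q -> 'rV[R]_n),
       open U -> frame A U X ->
       (forall (a : 'I_n) (p : tangent A),
          U (tproj p) -> euler_lagrange L G (X a) p = 0) /\
       (forall G' : tangent A -> ('rV[R]_n * 'rV[R]_n)%type,
          sode U G' ->
          (forall (a : 'I_n) (p : tangent A),
             U (tproj p) -> euler_lagrange L G' (X a) p = 0) ->
          forall p : tangent A, U (tproj p) -> G' p = G p)).
Proof.
move=> solution.
have solE G : solution G -> G = euler_lagrange_field L.
  move=> [sG elG]; apply/funext => p.
  (* These global fields depend on [p]: they are prescribed to be the standard basis at [p.1] only,
     which suffices since uniqueness is pointwise. *)
  have /choice[Z ZP] : forall a : 'I_n, exists Z : Q -> 'rV[R]_n,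
      smooth_vf A setT Z /\ Z p.1 = delta_mx 0 a.
    move=> a; have [Z sZ Zp] := global_vf_exists hQ p.1 (delta_mx 0 a).
    by exists Z.
  apply: (euler_lagrange_field_unique hQ hL hreg openT sG (X := Z)) => //.
  - by move=> a; case: (ZP a).
  - apply/eqP; rewrite eqEsubv subvf /=; apply/subvP => w _.
    rewrite (row_sum_delta w); apply: memv_suml => a _; apply: memvZ.
    apply: memv_span; apply/mapP; exists a; first by rewrite mem_enum.
    by case: (ZP a).
  - by move=> a; apply: elG; case: (ZP a).
split.
  exists (euler_lagrange_field L); split; last by move=> G /solE ->.
  split; first exact: sode_euler_lagrange_field.
  by move=> Z sZ p; exact: (euler_lagrange_field0 hQ hL hreg openT sZ).
(* The global solution is now the explicit field, so both claims about frames concern it. *)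
move=> G /solE -> U X oU [sX bX]; split=> [a p Up|G' sG' elG' p Up].
  exact: (euler_lagrange_field0 hQ hL hreg oU (sX a)).
apply: (euler_lagrange_field_unique hQ hL hreg oU sG' Up sX) => [|a].
  by have /andP[/eqP ? _] := bX _ Up.
exact: elG'.
Qed.
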